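(* Let $X$ be a real or complex Banach space and let $T:X\to X$ be a power bounded linear operator, i.e. $\sup_{n\ge 0}\|T^n\|<\infty$. Suppose that there exists a compact set $K\subseteq X$ such that $$\liminf_{n\to\infty}\rho(T^n x,K)=0\quad\text{for every } x\in X\text{ with }\|x\|\le 1 .$$ Then there exists a $T$-invariant subspace $L\subseteq X$ with $\dim L<\infty$ such that $$\lim_{n\to\infty}\rho(T^n x,L)=0\quad\text{for every } x\in X,$$ and there exists a closed $T$-invariant subspace $X_0\subseteq X$ such that $X=X_0\oplus L$ (so that $T^n=(T|_{X_0})^n\oplus (T|_L)^n$ for all $n$) and $T^n x_0\to 0$ as $n\to\infty$ for every $x_0\in X_0$. Moreover, $L$ is the linear span of the set of all returning vectors of $T$.
   Context: For $x\in X$ and $Y\subseteq X$, $\rho(x,Y)=\inf_{y\in Y}\|x-y\|$ denotes the distance from $x$ to $Y$. A vector $a\in X$ is called a returning vector of $T$ if $\liminf_{n\to\infty}\|T^n a-a\|=0$. *)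

(* Defs.v *)
(* Banach spaces over R or C, in MathComp-Analysis; the complex field over a
   [realType] is [R[i]] from mathcomp-real-closed. *)
From HB Require Import structures.
From mathcomp Require Import all_boot all_order all_algebra.
From mathcomp Require Import complex.
From mathcomp Require Import all_classical all_reals all_analysis.

Set Implicit Arguments.
Unset Strict Implicit.
Unset Printing Implicit Defensive.

Import Order.TTheory GRing.Theory Num.Theory.
Import numFieldNormedType.Exports.

Local Open Scope classical_set_scope.
Local Open Scope ring_scope.

Variant base_field := OverReal | OverComplex.

Definition base_fieldType (R : realType) (b : base_field) : numFieldType :=
  match b with
  | OverReal => R : numFieldType
  | OverComplex => (R[i])%C : numFieldType
  end.

Definition base_re (R : realType) (b : base_field) : base_fieldType R b -> R :=
  match b with
  | OverReal => fun x => x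
  | OverComplex => fun z => complex.Re z
  end.

(* In a normed module over R[i] the library norm `|x| is a nonnegative real
   element of R[i]; rnorm reads it as an element of R. *)
Definition rnorm (R : realType) (b : base_field)
  (X : normedModType (base_fieldType R b)) (x : X) : R := base_re `|x|.

(* Extended-real valued, so that the distance to the empty set is +oo. *)
Definition rdist (R : realType) (b : base_field)
  (X : normedModType (base_fieldType R b)) (x : X) (Y : set X) : \bar R :=
  ereal_inf [set (rnorm (x - y))%:E | y in Y].

Definition opnorm (R : realType) (b : base_field)
  (X : normedModType (base_fieldType R b)) (S : X -> X) : \bar R :=
  ereal_sup [set (rnorm (S x))%:E | x in [set x | rnorm x <= 1]].

Definition power_bounded (R : realType) (b : base_field)
  (X : normedModType (base_fieldType R b)) (T : X -> X) : Prop :=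
  (ereal_sup [set opnorm (iter n T) | n in [set: nat]] < +oo)%E.

Definition returning (R : realType) (b : base_field)
  (X : normedModType (base_fieldType R b)) (T : X -> X) : set X :=
  [set a | limn_einf (fun n => (rnorm (iter n T a - a))%:E) = 0%E].

Definition is_subspace (F : fieldType) (X : lmodType F) (L : set X) : Prop :=
  L 0 /\ forall (a : F) (u v : X), L u -> L v -> L (a *: u + v).

Definition linspan (F : fieldType) (X : lmodType F) (A : set X) : set X :=
  [set x | exists (n : nat) (c : 'I_n -> F) (a : 'I_n -> X),
     (forall i, A (a i)) /\ x = \sum_(i < n) c i *: a i].

Definition finite_dim (F : fieldType) (X : lmodType F) (L : set X) : Prop :=
  exists2 B : set X, finite_set B & L = linspan B.

Definition stable_under (X : Type) (T : X -> X) (L : set X) : Prop :=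
  T @` L `<=` L.

Definition direct_sum (F : fieldType) (X : lmodType F) (U V : set X) : Prop :=
  (forall x : X, exists u v, [/\ U u, V v & x = u + v]) /\
  U `&` V = [set 0].

(* Main.v *)
Require Import Defs.
From HB Require Import structures.
From mathcomp Require Import all_boot all_order all_algebra.
From mathcomp Require Import complex.
From mathcomp Require Import all_classical all_reals all_analysis.
From mathcomp Require Import ring lra.

(* The [limsup] of the norms [|T^n x|] is a seminorm [p] preserved by [T], with
   kernel [X0 = {x | T^n x --> 0}], and every [x] with [p x < 1] visits every
   neighbourhood of [K] infinitely often. Hence every vector is [p]-recurrent.

   The vectors with [p]-totally bounded orbit form a closed subspace [Z] whose
   unit ball is totally bounded, since each of its vectors is close to the orbit
   of one of finitely many. If [Z] were proper, the isometry induced on [X / Z]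
   would have an approximate eigenvalue (over [R]: an approximate quadratic
   factor); pushing approximate eigenvectors towards [K] produces a limit [a]
   outside [Z] such that [T (T a)] is a limit of vectors of
   [Z + F a + F (T a)], whose balls are totally bounded, so [a] is in [Z] after
   all. So [X / X0] is finite-dimensional.

   On returning vectors the norm is bounded by [p]. Simultaneous [p]-recurrence
   of pairs makes them a subspace [L], and completeness of [X] provides each [x]
   with a returning [l] such that [p (x - l) = 0]. Thus [X = X0 (+) L]. *)

Set Implicit Arguments.
Unset Strict Implicit.
Unset Printing Implicit Defensive.

Import Order.TTheory GRing.Theory Num.Theory.
Import numFieldNormedType.Exports.

Local Open Scope classical_set_scope.
Local Open Scope ring_scope.

(** * Polynomials acting through a linear map *)

Section PolyAction.
Variables (C : comNzRingType) (V : lmodType C) (T : {linear V -> V}).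

Definition act (q : {poly C}) (v : V) : V := \sum_(i < size q) q`_i *: iter i T v.

Lemma act_wide n (q : {poly C}) v : (size q <= n)%N -> act q v = \sum_(i < n) q`_i *: iter i T v.
Proof.
move=> le_qn; rewrite /act (big_ord_widen n (fun i => q`_i *: iter i T v)) //.
rewrite [RHS](bigID (fun i : 'I_n => (i < size q)%N)) /= [X in _ + X]big1 ?addr0 //.
by move=> i; rewrite -leqNgt => /leq_sizeP/(_ i (leqnn _)) ->; rewrite scale0r.
Qed.

Lemma actD p q v : act (p + q) v = act p v + act q v.
Proof.
pose n := maxn (size p) (size q).
rewrite (@act_wide n p) ?leq_maxl// (@act_wide n q) ?leq_maxr//.
rewrite (@act_wide n) ?size_polyD// -big_split /=.
by apply: eq_bigr => i _; rewrite coefD scalerDl.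
Qed.

Lemma actZ a p v : act (a *: p) v = a *: act p v.
Proof.
rewrite (@act_wide (size p)) ?size_scale_leq// scaler_sumr.
by apply: eq_bigr => i _; rewrite coefZ scalerA.
Qed.

Lemma act0 v : act 0 v = 0.
Proof. by rewrite /act size_poly0 big_ord0. Qed.

Lemma act_sum I (r : seq I) (P : pred I) (E : I -> {poly C}) v :
  act (\sum_(i <- r | P i) E i) v = \sum_(i <- r | P i) act (E i) v.
Proof. by apply: (big_morph (act^~ v)) => [p q|]; rewrite ?actD ?act0. Qed.

Lemma actC c v : act c%:P v = c *: v.
Proof. by rewrite (@act_wide 1) ?size_polyC_leq1// big_ord1 coefC. Qed.

Lemma actMX p v : act (p * 'X) v = act p (T v).
Proof.
rewrite (@act_wide (size p).+1); last first.
  by apply: leq_trans (size_polyMleq _ _) _; rewrite size_polyX addn2.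
rewrite big_ord_recl coefMX scale0r add0r /act.
by apply: eq_bigr => i _; rewrite coefMX lift0 iterSr.
Qed.

Lemma iter_linZ n a v : iter n T (a *: v) = a *: iter n T v.
Proof. by elim: n => //= n ->; rewrite linearZ. Qed.

Lemma actT p v : act p (T v) = T (act p v).
Proof.
rewrite /act linear_sum; apply: eq_bigr => i _.
by rewrite linearZ /= -iterSr.
Qed.

(** Products act as composites, so a factorization can be applied one factor at a time; the
    induction on [p] is Horner's scheme. *)
Lemma actM p q v : act (p * q) v = act p (act q v).
Proof.
elim/poly_ind: p v => [|p c IH] v; first by rewrite mul0r !act0.
rewrite mulrDl mul_polyC -mulrA (mulrC 'X) mulrA !actD actC actZ !actMX.
by rewrite IH actT.
Qed.

Lemma actX v : act 'X v = T v.
Proof. by rewrite -['X]mul1r actMX actC scale1r. Qed.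

Lemma actXn n v : act 'X^n v = iter n T v.
Proof.
elim: n v => [|n IH] v; first by rewrite expr0 actC scale1r.
by rewrite exprSr actMX IH -iterSr.
Qed.

End PolyAction.

(** The filter [j != k] removes every occurrence of [k], whence the condition that [s] has no
    repetition. *)
Lemma deriv_prod_uniq (C : comNzRingType) (I : eqType) (s : seq I)
    (f : I -> {poly C}) : uniq s ->
  (\prod_(k <- s) f k)^`() =
  \sum_(k <- s) (f k)^`() * \prod_(j <- s | j != k) f j.
Proof.
elim: s => [_|a s IH /= /andP[aNs us]]; first by rewrite !big_nil derivC.
rewrite !big_cons derivM IH // eqxx /= mulr_sumr; congr (_ * _ + _).
  rewrite big_seq [RHS]big_seq_cond; apply: eq_bigl => j.
  by case: eqVneq => [->|]; rewrite ?andbT // (negbTE aNs).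
apply: eq_big_seq => k ks; rewrite big_cons; case: eqVneq ks aNs => [<- ->//|_ _ _].
by rewrite mulrCA.
Qed.

(** * Partial fractions over scaled roots of unity *)

Section RootsIdentity.
Variables (C : fieldType) (n : nat) (z : 'I_n -> C).

(** Under [zE] and for nonzero [t], this is the quotient of ['X^n - t^n] by its [k]-th linear
    factor. *)
Definition cofactor_prod (t : C) (k : 'I_n) : {poly C} :=
  \prod_(j < n | j != k) ('X - (t * z j)%:P).

Hypothesis zE : 'X^n - 1 = \prod_k ('X - (z k)%:P).

Lemma prod_scaled_roots t : t != 0 ->
  'X^n - (t ^+ n)%:P = \prod_k ('X - (t * z k)%:P).
Proof.
move=> t0; have := congr1 (fun p => t ^+ n *: (p \Po (t^-1 *: 'X))) zE.
rewrite rmorphB rmorph1 /= rmorphXn /= comp_polyX exprZn scalerBr scalerA.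
rewrite -exprMn divff // expr1n scale1r alg_polyC => ->.
rewrite rmorph_prod /= -[X in t ^+ X](card_ord n) -prodr_const -scaler_prod.
apply: eq_bigr => k _.
by rewrite comp_polyB comp_polyX comp_polyC scalerBr scalerA divff // scale1r polyCM mul_polyC.
Qed.

Lemma cofactor_prodE t k : t != 0 ->
  ('X - (t * z k)%:P) * cofactor_prod t k = 'X^n - (t ^+ n)%:P.
Proof. by move=> t0; rewrite prod_scaled_roots // (bigD1 k). Qed.

(** For [P = 'X^n - t^n], the cofactors sum to the derivative of [P], and ['X] times that derivative
    is [n 'X^n]. Summing factor times cofactor over [k] gives [n P], and the difference is the
    constant. *)
Lemma sum_cofactor_prod t : t != 0 ->
  \sum_k (t * z k) *: cofactor_prod t k = (t ^+ n *+ n)%:P.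
Proof.
move=> t0.
have dE : 'X * ('X^n - (t ^+ n)%:P)^`() = 'X^n *+ n.
  rewrite derivB derivXn derivC subr0.
  by case: (n) => [|m] ; rewrite ?mulr0n ?mulr0 //= mulrnAr -exprS.
have sE : ('X^n - (t ^+ n)%:P)^`() = \sum_k cofactor_prod t k.
  rewrite prod_scaled_roots // /cofactor_prod.
  rewrite deriv_prod_uniq ?index_enum_uniq //.
  by apply: eq_bigr => k _; rewrite derivXsubC mul1r.
have : \sum_k ('X - (t * z k)%:P) * cofactor_prod t k = ('X^n - (t ^+ n)%:P) *+ n.
  under eq_bigr do rewrite cofactor_prodE //.
  by rewrite sumr_const card_ord.
under eq_bigr do rewrite mulrBl mul_polyC.
rewrite sumrB -mulr_sumr -sE dE mulrnBl => /addrI/oppr_inj ->.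
by rewrite polyCMn.
Qed.

(* [X^n - t^n] and [X^n - 1] have partial fraction expansions over their roots;
   their difference, after clearing denominators, is this identity. *)
Lemma cofactor_prod_diff t : t != 0 ->
  (t - 1) *: \sum_k z k *: ('X * (cofactor_prod t k * cofactor_prod 1 k)) =
  ((t ^+ n - 1) *+ n) *: 'X^n.
Proof.
move=> t0.
have key k : (t - 1) *: (z k *: ('X * (cofactor_prod t k * cofactor_prod 1 k))) =
   (t * z k) *: cofactor_prod t k * ('X^n - (1 ^+ n)%:P) -
   (1 * z k) *: cofactor_prod 1 k * ('X^n - (t ^+ n)%:P).
  rewrite -!(@cofactor_prodE _ k) ?oner_neq0 // -!mul_polyC !polyCM polyCB.
  ring.
rewrite scaler_sumr; under eq_bigr do rewrite key.
rewrite sumrB -!mulr_suml !sum_cofactor_prod ?oner_neq0 // expr1n -mul_polyC.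
rewrite !polyCMn polyCB polyC1 !mulrnAl -mulrnBl; congr (_ *+ n); ring.
Qed.

(** Supplies the two linear factors missing from a summand of [cofactor_prod_diff]; the result no
    longer depends on [k] and involves only ['X] and ['X^n]. *)
Lemma cofactor_prod_fill t k : t != 0 ->
  ('X - (t * z k)%:P) * (('X - (1 * z k)%:P) *
    ('X * (cofactor_prod t k * cofactor_prod 1 k))) =
  ('X^n - (t ^+ n)%:P) * (('X^n - 1%:P) * 'X).
Proof.
move=> t0; have E1 := cofactor_prodE k (oner_neq0 C); rewrite expr1n in E1.
rewrite -E1 -(cofactor_prodE k t0).
move: (cofactor_prod t k) (cofactor_prod 1 k) => p q; ring.
Qed.

End RootsIdentity.

(** * Real absolute values on the scalar field *)

Section BaseField.
Variables (R : realType) (b : base_field).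
Notation F := (base_fieldType R b).

Definition babs (c : F) : R := base_re `|c|.

Definition of_base (r : R) : F :=
  match b return base_fieldType R b with
  | OverReal => r
  | OverComplex => (r%:C)%C
  end.

Lemma base_reD (x y : F) : base_re (x + y) = base_re x + base_re y.
Proof. by case: b x y => //= -[? ?] []. Qed.

Lemma base_re_ge0 (x : F) : 0 <= x -> 0 <= base_re x.
Proof. by case: b x => //= -[u v]; rewrite lecE => /andP[]. Qed.

Lemma base_re_gt0 (x : F) : 0 < x -> 0 < base_re x.
Proof. by case: b x => //= -[u v]; rewrite ltcE => /andP[]. Qed.

Lemma base_re_le (x y : F) : x <= y -> base_re x <= base_re y.
Proof. by case: b x y => //= -[? ?] [? ?]; rewrite lecE => /andP[]. Qed.

Lemma base_reK (x : F) : 0 <= x -> of_base (base_re x) = x.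
Proof.
by rewrite /of_base; case: b x => //= -[u v]; rewrite lecE /= => /andP[/eqP -> _].
Qed.

Lemma of_base_divff (r : R) : r != 0 -> of_base r * of_base r^-1 = 1.
Proof. by rewrite /of_base; case: b => /= r0; rewrite -?rmorphM divff. Qed.

Lemma of_baseK (r : R) : base_re (of_base r) = r.
Proof. by rewrite /of_base; case: b. Qed.

Lemma of_base_ge0 (r : R) : 0 <= r -> 0 <= of_base r.
Proof. by rewrite /of_base; case: b => //= r0; rewrite lecE /= eqxx. Qed.

Lemma of_base_gt0 (r : R) : 0 < r -> 0 < of_base r.
Proof. by rewrite /of_base; case: b => //= r0; rewrite ltcE /= eqxx. Qed.

Lemma base_re_lt (x y : F) : 0 <= x -> 0 <= y -> (base_re x < base_re y) = (x < y).
Proof.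
case: b x y => //= -[? ?] [? ?]; rewrite !lecE ltcE /=.
by move=> /andP[/eqP -> _] /andP[/eqP -> _]; rewrite eqxx.
Qed.

Lemma base_reM (x y : F) : 0 <= x -> base_re (x * y) = base_re x * base_re y.
Proof.
case: b x y => //= -[u v] [u' v']; rewrite lecE => /andP[/eqP /= -> _].
by rewrite mul0r subr0.
Qed.

Lemma babs_ge0 c : 0 <= babs c.
Proof. exact: base_re_ge0. Qed.

Lemma babsM c d : babs (c * d) = babs c * babs d.
Proof. by rewrite /babs normrM base_reM. Qed.

Lemma babs1 : babs 1 = 1.
Proof. by rewrite /babs normr1; case: b. Qed.

Lemma babs0 : babs 0 = 0.
Proof. by rewrite /babs normr0; case: b. Qed.

Lemma babs_eq0 c : babs c = 0 -> c = 0.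
Proof.
move=> /(congr1 of_base); rewrite base_reK // => c0; apply/normr0_eq0.
by rewrite c0 /of_base; case: b.
Qed.

Lemma babsN c : babs (- c) = babs c.
Proof. by rewrite /babs normrN. Qed.

Lemma babs_of_base r : 0 <= r -> babs (of_base r) = r.
Proof. by move=> r0; rewrite /babs ger0_norm ?of_baseK ?of_base_ge0. Qed.

Lemma babsX c n : babs (c ^+ n) = babs c ^+ n.
Proof. by elim: n => [|n IH]; rewrite ?babs1 // !exprS babsM IH. Qed.

Lemma babsV c : babs c^-1 = (babs c)^-1.
Proof.
have [->|c0] := eqVneq c 0; first by rewrite invr0 babs0 invr0.
have b0 : babs c != 0 by apply: contra c0 => /eqP/babs_eq0 ->.
by apply: (mulfI b0); rewrite -babsM !divff // babs1.
Qed.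

Lemma babs_natmul n : babs n%:R = n%:R.
Proof. by rewrite /babs normr_nat; case: b => //=; elim: n => // n IH; rewrite -!natr1 raddfD /= IH. Qed.

End BaseField.

(** * Approximate eigenvalues of complex isometries *)

Section ApproxEigenvalue.
Variables (R : realType) (V : lmodType R[i]) (T : {linear V -> V}) (N : V -> R).
Notation cabs := (@babs R OverComplex).
Hypothesis N_add : forall u v, N (u + v) <= N u + N v.
(** The factor 2 admits [p x + p y] on a complexification, which is not exactly homogeneous for
    complex scalars. *)
Hypothesis N_scale : forall c u, N (c *: u) <= 2 * cabs c * N u.
Hypothesis N_iso : forall u, N (T u) = N u.

Lemma roots_of_unity n : (0 < n)%N -> exists z : 'I_n -> R[i],
  'X^n - 1 = \prod_k ('X - (z k)%:P) /\ forall k, cabs (z k) = 1.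
Proof.
move=> n0; have [r rE] := closed_field_poly_normal ('X^n - 1 : {poly R[i]}).
have mP : ('X^n - 1 : {poly R[i]}) \is monic by rewrite -polyC1 monicXnsubC.
rewrite (monicP mP) scale1r in rE.
have sr : size r = n.
  by apply: succn_inj; rewrite -(size_prod_XsubC r id) -rE -polyC1 size_XnsubC.
exists (fun k => r`_k); split; first by rewrite rE (big_nth 0) big_mkord sr.
move=> k; have : root ('X^n - 1) r`_k.
  by rewrite rE root_prod_XsubC mem_nth ?sr.
rewrite /root !hornerE subr_eq0 => /eqP/(congr1 cabs).
rewrite (@babsX R OverComplex) (@babs1 R OverComplex) => /eqP.
by rewrite pexpr_eq1 ?babs_ge0 // => /eqP.
Qed.

Lemma quasinorm0 : N 0 = 0.
Proof.
apply/le_anti/andP; split.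
  by have := N_scale 0 0; rewrite scale0r babs0 mulr0 mul0r.
by have := N_add 0 0; rewrite addr0; lra.
Qed.

Lemma quasinorm_unit c u : cabs c = 1 -> N (c *: u) <= 2 * N u.
Proof. by move=> c1; have := N_scale c u; rewrite c1 mulr1. Qed.

Lemma quasinorm_ge0 u : 0 <= N u.
Proof.
have := N_add u (-1 *: u); rewrite scaleN1r subrr quasinorm0 => h.
have := @quasinorm_unit (-1) u; rewrite (@babsN R OverComplex) babs1 scaleN1r => /(_ erefl).
by lra.
Qed.

Lemma quasinorm_iter n u : N (iter n T u) = N u.
Proof. by elim: n => //= n <-. Qed.

Lemma quasinorm_subZ c u w : N (u - c *: w) <= N u + 2 * cabs c * N w.
Proof.
by rewrite -scaleNr (le_trans (N_add _ _)) // lerD2l -(@babsN R OverComplex) N_scale.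
Qed.

Lemma act_XsubC c u : act T ('X - c%:P) u = T u - c *: u.
Proof. by rewrite -polyCN actD actC scaleNr actX. Qed.

Lemma act_XnsubC n c u : act T ('X^n - c%:P) u = iter n T u - c *: u.
Proof. by rewrite -polyCN actD actC scaleNr actXn. Qed.

Lemma quasinorm_sum n (f : 'I_n -> V) B :
  (forall k, N (f k) <= B) -> N (\sum_k f k) <= n%:R * B.
Proof.
elim: n f => [|n IH] f fB; first by rewrite big_ord0 quasinorm0 mul0r.
rewrite big_ord_recr -natr1 mulrDl mul1r (le_trans (N_add _ _)) //.
by rewrite lerD // IH.
Qed.

(** Bernoulli's inequality; the value 3 is large enough to refute the last estimate of
    [approx_eigenvalue]. *)
Lemma bernoulli_large (d : R) : 0 < d -> exists2 n, (0 < n)%N & 3 <= (1 + d) ^+ n.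
Proof.
move=> d0.
have bern n : 1 + n%:R * d <= (1 + d) ^+ n.
  elim: n => [|n IH]; first by rewrite mul0r addr0 expr0.
  have n0 : 0 <= n%:R :> R by [].
  by rewrite exprS -natr1; nra.
exists (Num.trunc (2 / d)).+1 => //; apply: le_trans (bern _).
have := truncnS_gt (2 / d); rewrite ltr_pdivrMr //; lra.
Qed.

(* If every [T - c] with [cabs c <= 2] were bounded below by [eta], applying
   [cofactor_prod_diff] at [t = 1 + delta] to a vector would bound
   [t ^+ n - 1] by a small multiple of [t ^+ n], uniformly in [n]. *)
Lemma approx_eigenvalue eta : 0 < eta -> (exists v, 0 < N v) ->
  exists2 c, cabs c <= 2 & exists2 v, 0 < N v & N (T v - c *: v) <= eta * N v.
Proof.
(* The slash separates the generalized variable from the assumption [eta <= 1], which keeps [1 + d]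
   at most 2 below. *)
wlog eta1 : eta / eta <= 1 => [hw eta0 ex|].
  have [|//|//|c c2 [v v0 le]] := hw (Num.min eta 1); first by rewrite ge_min lexx orbT.
    by rewrite lt_min eta0 ltr01.
  exists c => //; exists v => //; apply: le_trans le _.
  by rewrite ler_wpM2r ?quasinorm_ge0 // ge_min lexx.
move=> eta0 [v v0]; apply: contrapT => nex.
have low c u : cabs c <= 2 -> eta * N u <= N (T u - c *: u).
  move=> c2; rewrite leNgt; apply/negP => lt; apply: nex; exists c => //.
  exists u; last exact: ltW.
  rewrite lt_neqAle quasinorm_ge0 andbT; apply/eqP => u0.
  by move: lt; rewrite -u0 mulr0 ltNge quasinorm_ge0.
(* The constant 100 leaves the factor [24 / 100] in the closing comparison, and [d <= 1] brings the
   scalars [t * z k] into the range of [low]. *)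
pose d := eta ^+ 2 / 100; have d0 : 0 < d by rewrite divr_gt0 ?exprn_gt0.
have d1 : d <= 1 by rewrite /d; nra.
have [n n0 n3] := bernoulli_large d0.
have [z [zE z1]] := roots_of_unity n0.
pose t : R[i] := @of_base R OverComplex (1 + d).
have tabs : cabs t = 1 + d by apply: (@babs_of_base R OverComplex); lra.
have t0 : t != 0.
  by apply/eqP => /(congr1 cabs); rewrite tabs (@babs0 R OverComplex); lra.
pose w k := act T ('X * (cofactor_prod z t k * cofactor_prod z 1 k)) v.
pose q := (1 + d) ^+ n; rewrite -/q in n3.
(* Two applications of [low] cost a factor [eta ^+ 2]; the completed polynomial contributes
   [1 + 2 * q] from ['X^n - t^n] and 3 from ['X^n - 1]. *)
have wB k : N (w k) <= 3 * (1 + 2 * q) * N v / eta ^+ 2.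
  rewrite ler_pdivlMr ?exprn_gt0 //.
  have -> : N (w k) * eta ^+ 2 = eta * (eta * N (w k)) by ring.
  apply: (@le_trans _ _ (eta * N (act T ('X - (1 * z k)%:P) (w k)))).
    by rewrite ler_wpM2l ?(ltW eta0) // act_XsubC mul1r low // z1; lra.
  set u := act _ _ _; apply: (@le_trans _ _ (N (act T ('X - (t * z k)%:P) u))).
    by rewrite act_XsubC low // (@babsM R OverComplex) z1 tabs; lra.
  have -> : act T ('X - (t * z k)%:P) u =
      act T ('X^n - (t ^+ n)%:P) (act T ('X^n - 1%:P) (T v)).
    by rewrite /u /w -!actM -mulrA (cofactor_prod_fill zE k t0) !actM actX.
  rewrite !act_XnsubC; set y := _ - 1 *: _.
  have yB : N y <= 3 * N v.
    apply: le_trans (quasinorm_subZ _ _ _) _.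
    by rewrite (@babs1 R OverComplex) quasinorm_iter N_iso; lra.
  apply: le_trans (quasinorm_subZ _ _ _) _.
  rewrite quasinorm_iter (@babsX R OverComplex) tabs -/q.
  have q0 : 0 <= 1 + 2 * q by rewrite addr_ge0 // mulr_ge0 // exprn_ge0 //; lra.
  by have := ler_wpM2l q0 yB; lra.
have /(congr1 (fun p => N (act T p v))) := cofactor_prod_diff zE t0.
rewrite !actZ act_sum actXn => key.
pose B := 3 * (1 + 2 * q) * N v / eta ^+ 2.
have up : N ((t - 1) *: \sum_k act T (z k *: ('X * (cofactor_prod z t k * cofactor_prod z 1 k))) v)
    <= 2 * d * (n%:R * (2 * B)).
  apply: le_trans (N_scale _ _) _.
  have -> : cabs (t - 1) = d.
    have -> : t - 1 = @of_base R OverComplex d.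
      by rewrite /t /of_base rmorphD rmorph1 addrAC subrr add0r.
    by apply: babs_of_base; exact: ltW.
  rewrite ler_wpM2l //; first by lra.
  apply: quasinorm_sum => k; rewrite actZ.
  by apply: le_trans (quasinorm_unit _ (z1 k)) _; rewrite ler_wpM2l // wB.
rewrite key in up.
set c := _ *+ n in up.
have cE : cabs c = (q - 1) * n%:R.
  rewrite /c -[_ *+ n]mulr_natr (@babsM R OverComplex) (@babs_natmul R OverComplex).
  congr (_ * _); rewrite /t /of_base -rmorphXn -(rmorph1 (real_complex R)) -rmorphB /=.
  by apply: (@babs_of_base R OverComplex); rewrite -/q; lra.
have nR : 0 < n%:R :> R by rewrite ltr0n.
have c0 : 0 < cabs c by rewrite cE mulr_gt0 //; lra.
have cn0 : c != 0.
  by apply/eqP => c0'; move: c0; rewrite c0' (@babs0 R OverComplex) ltxx.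
(* Since [N] is homogeneous only up to a factor, the lower bound for [N (c *: _)] comes from scaling
   back by [c^-1]. *)
have : cabs c * N v <= 2 * N (c *: iter n T v).
  rewrite -(quasinorm_iter n v) -[in leLHS](scale1r (iter n T v)) -(mulVf cn0) -scalerA.
  rewrite -ler_pdivlMl //; apply: le_trans (N_scale _ _) _.
  by rewrite (@babsV R OverComplex) le_eqVlt; apply/orP; left; apply/eqP; ring.
move=> /le_trans/(_ (ler_wpM2l _ up)) => /(_ ltac:(by [])).
have -> : 2 * (2 * d * (n%:R * (2 * B))) = (24 / 100) * (1 + 2 * q) * n%:R * N v.
  by rewrite /B /d; field; exact: lt0r_neq0.
(* What remains, [q - 1 <= (24 / 100) * (1 + 2 * q)], contradicts [3 <= q]. *)
rewrite cE ler_pM2r // ler_pM2r //; lra.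
Qed.
End ApproxEigenvalue.

(** * Seminorms *)

Record seminorm (R : realType) (b : base_field) (X : lmodType (base_fieldType R b))
    (p : X -> R) : Prop := Seminorm {
  seminormD : forall x y, p (x + y) <= p x + p y;
  seminormZ : forall c x, p (c *: x) = babs c * p x }.

Section SeminormTheory.
Variables (R : realType) (b : base_field) (X : lmodType (base_fieldType R b)).
Variables (p : X -> R) (p_sn : seminorm p).

Lemma seminorm0 : p 0 = 0.
Proof. by rewrite -(scale0r 0) (seminormZ p_sn) babs0 mul0r. Qed.

Lemma seminormN x : p (- x) = p x.
Proof. by rewrite -scaleN1r (seminormZ p_sn) babsN babs1 mul1r. Qed.

Lemma seminorm_ge0 x : 0 <= p x.
Proof. by have := seminormD p_sn x (- x); rewrite subrr seminorm0 seminormN; lra. Qed.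

Lemma seminormB x y : p (x - y) <= p x + p y.
Proof. by rewrite -(seminormN y) (seminormD p_sn). Qed.

Lemma seminorm_distC x y : p (x - y) = p (y - x).
Proof. by rewrite -seminormN opprB. Qed.

Lemma seminorm_triangle z x y : p (x - y) <= p (x - z) + p (z - y).
Proof. by rewrite -[x - y](subrKA z) (seminormD p_sn). Qed.

Lemma seminorm_le_dist x y : p x <= p y + p (x - y).
Proof. by rewrite -[x in leLHS](subrKC y) (seminormD p_sn). Qed.

Lemma seminorm_normalize r x : 0 <= r -> p (of_base b r *: x) = r * p x.
Proof. by move=> r0; rewrite (seminormZ p_sn) babs_of_base. Qed.

End SeminormTheory.

(** * Complexification of a real module *)

Section Complexification.
Variables (R : realType) (X : lmodType R).

(** The pair [(x, y)] stands for [x + 'i y]. Only the additive group of the product is inherited,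
    leaving room for the scalars [R[i]]. *)
Definition complexified : Type := (X * X)%type.
HB.instance Definition _ := GRing.Zmodule.on complexified.

Definition complexified_scale (c : R[i]) (v : complexified) : complexified :=
  (complex.Re c *: v.1 - complex.Im c *: v.2, complex.Re c *: v.2 + complex.Im c *: v.1).

Fact complexified_scaleA c d v :
  complexified_scale c (complexified_scale d v) = complexified_scale (c * d) v.
Proof.
case: c d v => [a a'] [d d'] [x y]; rewrite /complexified_scale /=.
congr pair; rewrite !scalerDr ?scalerN !scalerA !scalerDl ?scaleNr.
  by rewrite opprD [- _ - _]addrC addrACA -opprD.
by rewrite [_ - (_ : X) in LHS]addrC addrACA.
Qed.

Fact complexified_scale1 : left_id 1 complexified_scale.
Proof.
by case=> x y; rewrite /complexified_scale /= !scale1r !scale0r subr0 addr0.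
Qed.

Fact complexified_scaleDr : right_distributive complexified_scale +%R.
Proof.
move=> c [x y] [x' y']; rewrite /complexified_scale /=.
by congr pair; rewrite /= !scalerDr ?opprD addrACA.
Qed.

Fact complexified_scaleDl v :
  {morph complexified_scale^~ v : c d / c + d}.
Proof.
case: v => x y [a a'] [d d']; rewrite /complexified_scale /=.
by congr pair; rewrite /= !scalerDl ?opprD addrACA.
Qed.

HB.instance Definition _ := GRing.Zmodule_isLmodule.Build R[i] complexified
  complexified_scaleA complexified_scale1 complexified_scaleDr complexified_scaleDl.

Variable T : {linear X -> X}.

Definition complexified_map (v : complexified) : complexified := (T v.1, T v.2).

Fact complexified_map_linear : linear complexified_map.
Proof.
move=> c [x y] [x' y']; rewrite /complexified_map /=.
by congr pair; rewrite /= !raddfD /= ?raddfN /= !linearZ.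
Qed.

HB.instance Definition _ := GRing.isLinear.Build R[i] complexified complexified _
  complexified_map complexified_map_linear.

End Complexification.

(* With [e1 + 'i e2 = (T - (a + 'i a')) (x + 'i y)], the identity
   [T^2 - 2 a T + a^2 + a'^2 = (T - (a - 'i a')) (T - (a + 'i a'))]. *)
Lemma quadratic_factor (R : comNzRingType) (X : lmodType R) (T : {linear X -> X})
    (a a' : R) (x y : X) :
  let e1 := T x - (a *: x - a' *: y) in let e2 := T y - (a *: y + a' *: x) in
  T (T x) + (- 2 * a) *: T x + (a ^+ 2 + a' ^+ 2) *: x =
  T e1 - a *: e1 - a' *: e2.
Proof.
have zmod_id (A P Q U V W : X) :
  A - (P - Q) - (P - (U - V)) - (Q - (V + W)) = A - P - P + (U + W).
  rewrite !opprB (addrAC _ (U - V - P)) -(addrA A) [Q - P + _]addrC subrKA.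
  rewrite -addrA [V + W - P + _]addrACA [V + W + _]addrC [U - V + _]addrA subrK.
  by rewrite [U + W + _]addrC !addrA.
move=> e1 e2; rewrite /e1 /e2 ![T (_ - _)]linearB /= ![T (_ *: _)]linearZ /= !scalerBr !scalerDr.
rewrite !scalerA [a' * a]mulrC -!expr2 zmod_id scalerDl; congr (_ + _).
by rewrite mulNr scaleNr mulr_natl mulr2n scalerDl opprD addrA.
Qed.

(** * Approximate quadratic factors over both fields *)

Section ApproxQuadratic.
Variable R : realType.

(** An approximate eigenvector [x + 'i y] of the complexification makes the real quadratic with the
    eigenvalue and its conjugate as roots small on both [x] and [y]; at least one of them satisfies
    the relative bound with positive seminorm. *)
Lemma approx_quadratic_real (X : lmodType (base_fieldType R OverReal))
    (T : {linear X -> X}) (p : X -> R) (eta : R) :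
  seminorm p -> (forall x, p (T x) = p x) -> 0 < eta -> (exists v, 0 < p v) ->
  exists c d, [/\ babs c <= 4, babs d <= 4 &
    exists2 v, 0 < p v & p (T (T v) + c *: T v + d *: v) <= eta * p v].
Proof.
move=> p_sn p_iso eta0 [w w0].
pose N (v : complexified X) : R := p v.1 + p v.2.
have Nadd u v : N (u + v) <= N u + N v.
  by rewrite /N addrACA lerD // (seminormD p_sn).
have absRe (z : R[i]) : `|complex.Re z| <= @babs R OverComplex z.
  rewrite /babs normc_def /= -sqrtr_sqr ler_wsqrtr // lerDl sqr_ge0 //.
have absIm (z : R[i]) : `|complex.Im z| <= @babs R OverComplex z.
  rewrite /babs normc_def /= -sqrtr_sqr ler_wsqrtr // lerDr sqr_ge0 //.
have pZ (a : R) x : p (a *: x) = `|a| * p x by exact: (seminormZ p_sn).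
have p0 := seminorm_ge0 p_sn.
have Nscale (c : R[i]) u : N (c *: u) <= 2 * @babs R OverComplex c * N u.
  case: u => x y; set k := @babs R OverComplex c; rewrite /N /=.
  apply: le_trans (lerD (seminormB p_sn _ _) (seminormD p_sn _ _)) _.
  rewrite !pZ; have xy0 : 0 <= p x + p y by rewrite addr_ge0.
  have c2 : `|complex.Re c| + `|complex.Im c| <= 2 * k.
    by rewrite mulr2n mulrDl mul1r lerD.
  by have := ler_wpM2r xy0 c2; lra.
have Niso u : N (complexified_map T u) = N u by rewrite /N /= !p_iso.
(* [Q x] and [Q y] together will cost at most [5 * (p e1 + p e2)], so the error [eta / 6]
   suffices. *)
have [||z z2 [[x y] v0]] := @approx_eigenvalue R (complexified X)
  (complexified_map T) N Nadd Nscale Niso (eta / 6).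
- by rewrite divr_gt0.
- by exists (w, 0); rewrite /N /= (seminorm0 p_sn) addr0.
pose a := complex.Re z; pose a' := complex.Im z.
have ha : `|a| <= 2 := le_trans (absRe z) z2.
have ha' : `|a'| <= 2 := le_trans (absIm z) z2.
pose e1 := T x - (a *: x - a' *: y); pose e2 := T y - (a *: y + a' *: x).
rewrite {1}/N /= -/a -/a' -/e1 -/e2 => le.
pose Q u := T (T u) + (- 2 * a) *: T u + (a ^+ 2 + a' ^+ 2) *: u.
have Qx : Q x = T e1 - a *: e1 - a' *: e2 by exact: quadratic_factor.
have Qy : Q y = T e2 - a *: e2 + a' *: e1.
  (* [y + 'i x] is ['i] times the conjugate of [x + 'i y], hence the conjugate scalar and the
     exchange of [e1] and [e2]. *)
  have := quadratic_factor T a (- a') y x.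
  by rewrite /= sqrrN !scaleNr !opprK.
have a2 : `|- 2 * a| <= 4 by rewrite mulNr normrN normrM [`|2|]ger0_norm //; lra.
have b2 : `|a ^+ 2 + a' ^+ 2| <= 4.
  have := z2; rewrite /babs normc_def /= -/a -/a' => s2.
  have nn : 0 <= a ^+ 2 + a' ^+ 2 by rewrite addr_ge0 ?sqr_ge0.
  rewrite ger0_norm // -(sqr_sqrtr nn); have := sqrtr_ge0 (a ^+ 2 + a' ^+ 2); nra.
exists (- 2 * a), (a ^+ 2 + a' ^+ 2); split => //; apply: contrapT => nex.
have low u : p (Q u) <= eta * p u -> p u = 0.
  move=> h; apply/eqP; apply: contrapT => u0; apply: nex; exists u => //.
  by rewrite lt_neqAle p0 andbT eq_sym; apply/negP.
have QxB : p (Q x) <= 3 * p e1 + 2 * p e2.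
  rewrite Qx; apply: le_trans (seminormB p_sn _ _) _.
  have := seminormB p_sn (T e1) (a *: e1); rewrite !pZ p_iso.
  by have := ler_wpM2r (p0 e1) ha; have := ler_wpM2r (p0 e2) ha'; lra.
have QyB : p (Q y) <= 3 * p e2 + 2 * p e1.
  rewrite Qy; apply: le_trans (seminormD p_sn _ _) _.
  have := seminormB p_sn (T e2) (a *: e2); rewrite !pZ p_iso.
  by have := ler_wpM2r (p0 e2) ha; have := ler_wpM2r (p0 e1) ha'; lra.
have le' : 6 * (p e1 + p e2) <= eta * (p x + p y).
  by move: le; rewrite /N /=; lra.
move: v0; rewrite /N /= => v0.
have [hx|hx] := leP (p (Q x)) (eta * p x).
  have x0 := low _ hx; rewrite x0 in le' v0.
  suff : p y = 0 by lra.
  by apply: low; move: (p0 e1) (p0 e2); lra.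
have [hy|hy] := leP (p (Q y)) (eta * p y).
  have y0 := low _ hy; rewrite y0 in le' v0.
  suff : p x = 0 by lra.
  by apply: low; move: (p0 e1) (p0 e2); lra.
by move: (p0 e1) (p0 e2); lra.
Qed.

(* Over [R] no eigenvalue need exist, hence quadratic polynomials in [T]; the
   complex case follows the same pattern so that both fields can be treated
   together. *)
Lemma approx_quadratic (b : base_field) (X : lmodType (base_fieldType R b))
    (T : {linear X -> X}) (p : X -> R) (eta : R) :
  seminorm p -> (forall x, p (T x) = p x) -> 0 < eta -> (exists v, 0 < p v) ->
  exists c d, [/\ babs c <= 4, babs d <= 4 &
    exists2 v, p v = 1 & p (T (T v) + c *: T v + d *: v) <= eta].
Proof.
move=> p_sn p_iso eta0 ex.
suff [c [d [c4 d4 [v v0 le]]]] : exists c d, [/\ babs c <= 4, babs d <= 4 &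
    exists2 v, 0 < p v & p (T (T v) + c *: T v + d *: v) <= eta * p v].
  exists c, d; split=> //; pose r := of_base b (p v)^-1.
  have pr u : p (r *: u) = (p v)^-1 * p u.
    by apply: seminorm_normalize => //; rewrite invr_ge0 ltW.
  exists (r *: v); first by rewrite pr mulVf // lt0r_neq0.
  rewrite !linearZ /= !(scalerA, mulrC _ r) -!(scalerA r) -!scalerDr pr.
  by rewrite ler_pdivrMl // mulrC.
case: b X T p p_sn p_iso ex => X T p p_sn p_iso ex.
  exact: approx_quadratic_real.
have pZ2 (c : base_fieldType R OverComplex) u : p (c *: u) <= 2 * babs c * p u.
  by rewrite (seminormZ p_sn) -mulrA ler_peMl // ?ler1n // mulr_ge0 ?babs_ge0 // (seminorm_ge0 p_sn).
have [c c2 [v v0 le]] :=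
  @approx_eigenvalue R X T p (seminormD p_sn) pZ2 p_iso eta eta0 ex.
(* The quadratic is ['X^2 - c 'X], that is ['X - c] followed by [T], which preserves [p]. *)
exists (- c), 0; split; first by rewrite babsN; apply: le_trans c2 _; lra.
  by rewrite babs0.
exists v => //; rewrite scale0r addr0 scaleNr -linearZ /= -linearB p_iso //.
Qed.
End ApproxQuadratic.

(** * Scalar nets, subspaces and total boundedness *)

Lemma scalar_net (R : realType) (b : base_field) (r e : R) : 0 < e ->
  exists s : seq (base_fieldType R b),
    forall c, babs c <= r -> exists2 d, d \in s & babs (c - d) < e.
Proof.
move=> e0.
have real_net (eps : R) : 0 < eps -> exists s : seq R,
    forall c : R, `|c| <= r -> exists2 d, d \in s & `|c - d| < eps.
  move=> eps0; pose g := [seq k%:R * eps | k <- iota 0 (Num.trunc (r / eps)).+1].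
  exists (g ++ [seq - x | x <- g]).
  have pos (c : R) : 0 <= c -> c <= r -> exists2 d, d \in g & `|c - d| < eps.
    move=> c0 cr; have /truncn_itv/andP[t1 t2] : 0 <= c / eps by rewrite divr_ge0 // ltW.
    exists ((Num.trunc (c / eps))%:R * eps).
      apply/mapP; exists (Num.trunc (c / eps)) => //.
      rewrite mem_iota /= add0n ltnS truncn_le_nat.
      by apply: le_lt_trans (truncnS_gt _); rewrite ler_pM2r ?invr_gt0.
    rewrite ger0_norm ?subr_ge0 -?ler_pdivlMr //.
    by move: t2; rewrite ltr_pdivrMr // -natr1 mulrDl mul1r; lra.
  move=> c cr; have [c0|c0] := leP 0 c.
    have [|d dg dlt] := pos c c0; first by rewrite -(ger0_norm c0).
    by exists d => //; rewrite mem_cat dg.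
  have [|//|d dg dlt] := pos (- c); first by rewrite oppr_ge0 ltW.
    by rewrite -(ltr0_norm c0).
  exists (- d); first by rewrite mem_cat; apply/orP; right; apply/mapP; exists d.
  by rewrite -normrN opprD opprK.
case: b; first exact: real_net.
have [|s sP] := real_net (e / 2); first by rewrite divr_gt0.
exists [seq (x +i* y)%C | x <- s, y <- s] => -[x y] cr.
have le2 (u v : R) : `|u| <= @babs R OverComplex (u +i* v)%C /\ `|v| <= @babs R OverComplex (u +i* v)%C.
  rewrite /babs normc_def /= -!sqrtr_sqr; split; rewrite ler_wsqrtr // ?lerDl ?lerDr sqr_ge0 //.
have [hx hy] := le2 x y.
have [x' x's lx] := sP x (le_trans hx cr).
have [y' y's ly] := sP y (le_trans hy cr).
exists (x' +i* y')%C; first by apply/allpairsP; exists (x', y').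
rewrite /babs normc_def /=.
have -> : e = Num.sqrt (e ^+ 2) by rewrite sqrtr_sqr gtr0_norm.
rewrite ltr_sqrt ?exprn_gt0 // -(real_normK (num_real (x - x'))) -(real_normK (num_real (y - y'))).
have := normr_ge0 (x - x'); have := normr_ge0 (y - y'); nra.
Qed.

Section Subspaces.
Variables (F : fieldType) (X : lmodType F).
Implicit Types W : set X.

Lemma subspace0 W : is_subspace W -> W 0.
Proof. by case. Qed.

Lemma subspaceZ W c u : is_subspace W -> W u -> W (c *: u).
Proof. by case=> W0 WP Wu; rewrite -[_ *: _]addr0; apply: WP. Qed.

Lemma subspaceD W u v : is_subspace W -> W u -> W v -> W (u + v).
Proof. by case=> W0 WP Wu Wv; rewrite -[u]scale1r; apply: WP. Qed.

Lemma subspaceB W u v : is_subspace W -> W u -> W v -> W (u - v).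
Proof. by move=> Ws Wu Wv; rewrite -scaleN1r addrC; apply: (proj2 Ws). Qed.

(** [W + F a]; since [a] may already lie in [W], the coefficient [c] is not determined in
    general. *)
Definition addline W (a : X) : set X := [set x | exists c, W (x - c *: a)].

Lemma addline_subspace W a : is_subspace W -> is_subspace (addline W a).
Proof.
move=> Ws; split; first by exists 0; rewrite scale0r subr0; exact: subspace0.
move=> k u v [c Wu] [d Wv]; exists (k * c + d).
rewrite scalerDl opprD addrACA -scalerA -scalerBr.
exact: (proj2 Ws).
Qed.

Lemma addline_self W a : is_subspace W -> addline W a a.
Proof. by move=> Ws; exists 1; rewrite scale1r subrr; exact: subspace0. Qed.

Lemma sub_addline W a : W `<=` addline W a.
Proof. by move=> x Wx; exists 0; rewrite scale0r subr0. Qed.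

End Subspaces.

Section TotalBoundedness.
Variables (R : realType) (b : base_field) (X : lmodType (base_fieldType R b)).
Variables (p : X -> R) (p_sn : seminorm p).
Implicit Types A B W : set X.

(** Net points may be any vectors, so that a subset inherits the nets of a larger set. *)
Definition tot_bounded A := forall e, 0 < e ->
  exists s : seq X, forall x, A x -> exists2 y, y \in s & p (x - y) < e.

Definition ball_tot_bounded W := forall r, tot_bounded [set x | W x /\ p x <= r].

Definition pclosure W : set X :=
  [set x | forall e, 0 < e -> exists2 w, W w & p (x - w) < e].

Lemma tot_bounded_sub A B : A `<=` B -> tot_bounded B -> tot_bounded A.
Proof.
by move=> AB tB e e0; have [s sP] := tB e e0; exists s => x /AB/sP.
Qed.

Lemma tot_boundedD A B : tot_bounded A -> tot_bounded B ->
  tot_bounded [set x | exists u v, [/\ A u, B v & x = u + v]].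
Proof.
move=> tA tB e e0; have e2 : 0 < e / 2 by rewrite divr_gt0.
have [s sP] := tA _ e2; have [t tP] := tB _ e2.
exists [seq u + v | u <- s, v <- t] => _ [u [v [Au Bv ->]]].
have [u' u's lu] := sP _ Au; have [v' v't lv] := tP _ Bv.
exists (u' + v'); first by apply/allpairsP; exists (u', v').
by rewrite opprD addrACA; have := seminormD p_sn (u - u') (v - v'); lra.
Qed.

Lemma tot_boundedZ c A : tot_bounded A -> tot_bounded [set c *: x | x in A].
Proof.
move=> tA e e0; have c1 : 0 < babs c + 1 by have := babs_ge0 c; lra.
have [s sP] := tA (e / (babs c + 1)) (divr_gt0 e0 c1).
exists [seq c *: u | u <- s] => _ [u Au <-]; have [v vs] := sP _ Au.
rewrite ltr_pdivlMr // => lv; exists (c *: v); first exact: map_f.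
rewrite -scalerBr (seminormZ p_sn); have := seminorm_ge0 p_sn (u - v); nra.
Qed.

Lemma tot_bounded_segment a r : tot_bounded [set c *: a | c in [set c | babs c <= r]].
Proof.
move=> e e0; have a1 : 0 < p a + 1 by have := seminorm_ge0 p_sn a; lra.
have [s sP] := scalar_net b r (divr_gt0 e0 a1).
exists [seq c *: a | c <- s] => _ [c cr <-]; have [d ds] := sP _ cr.
rewrite ltr_pdivlMr // => ld; exists (d *: a); first exact: map_f.
rewrite -scalerBl (seminormZ p_sn); have := babs_ge0 (c - d); nra.
Qed.

Lemma sub_pclosure W : W `<=` pclosure W.
Proof. by move=> x Wx e e0; exists x => //; rewrite subrr (seminorm0 p_sn). Qed.

Lemma pclosureK W : pclosure (pclosure W) `<=` pclosure W.
Proof.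
move=> x cx e e0; have e2 : 0 < e / 2 by rewrite divr_gt0.
have [y cy xy] := cx _ e2; have [w Ww yw] := cy _ e2.
by exists w => //; have := seminorm_triangle p_sn y x w; lra.
Qed.

Lemma ball_tot_bounded_sub W W' : W `<=` W' ->
  ball_tot_bounded W' -> ball_tot_bounded W.
Proof.
by move=> WW' tW r; apply: tot_bounded_sub (tW r) => x [/WW' W'x xr].
Qed.

Lemma ball_tot_bounded_pclosure W :
  ball_tot_bounded W -> ball_tot_bounded (pclosure W).
Proof.
move=> tW r e e0; have e2 : 0 < e / 2 by rewrite divr_gt0.
have [s sP] := tW (r + e / 2) _ e2; exists s => x [cx xr].
have [w Ww xw] := cx _ e2; have [|y ys wy] := sP w.
  by split => //; have := seminorm_le_dist p_sn w x; rewrite (seminorm_distC p_sn); lra.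
by exists y => //; have := seminorm_triangle p_sn w x y; lra.
Qed.

Lemma not_pclosure W a : ~ pclosure W a ->
  exists2 d, 0 < d & forall w, W w -> d <= p (a - w).
Proof.
move=> nc; apply: contrapT => nd; apply: nc => e e0; apply: contrapT => nw.
apply: nd; exists e => // w Ww; rewrite leNgt; apply/negP => lt.
by apply: nw; exists w.
Qed.

(** For nonzero [c], [x = c (a - w)] with [w] in [W]: the coordinate along [a] is bounded when [a]
    is at positive distance from [W]. *)
Lemma coord_bound W a c d x : is_subspace W -> (forall w, W w -> d <= p (a - w)) ->
  W (x - c *: a) -> babs c * d <= p x.
Proof.
move=> Ws da Wx; have [->|c0] := eqVneq c 0.
  by rewrite babs0 mul0r (seminorm_ge0 p_sn).
have := da _ (subspaceZ (- c^-1) Ws Wx).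
rewrite scaleNr opprK scalerBr scalerA mulVf // scale1r addrC subrK.
by rewrite (seminormZ p_sn) babsV ler_pdivlMl // lt_neqAle babs_ge0 andbT eq_sym;
  apply: contra c0 => /eqP/babs_eq0 ->.
Qed.

Lemma addline_sub_pclosure W a : is_subspace W -> pclosure W a ->
  addline W a `<=` pclosure W.
Proof.
move=> Ws ca x [c Wx] e e0.
have c1 : 0 < babs c + 1 by have := babs_ge0 c; lra.
have [w Ww] := ca _ (divr_gt0 e0 c1); rewrite ltr_pdivlMr // => lw.
exists (x - c *: a + c *: w).
  by apply: subspaceD => //; exact: subspaceZ.
rewrite opprD opprB addrA subrKC -scalerBr (seminormZ p_sn).
by have := seminorm_ge0 p_sn (a - w); nra.
Qed.

(** Either [a] lies in the closure of [W], which then contains [addline W a], or the coordinate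
    along [a] is bounded and the ball lies in the sum of a ball of [W] and a segment. *)
Lemma ball_tot_bounded_addline W a : is_subspace W ->
  ball_tot_bounded W -> ball_tot_bounded (addline W a).
Proof.
move=> Ws tW; have [ca|/not_pclosure[d d0 da]] := pselect (pclosure W a).
  apply: (ball_tot_bounded_sub _ (ball_tot_bounded_pclosure tW)).
  exact: addline_sub_pclosure.
move=> r; pose B := r / d.
apply: tot_bounded_sub (tot_boundedD (tW (r + B * p a)) (tot_bounded_segment a B)).
move=> x [[c Wx] xr]; exists (x - c *: a), (c *: a); rewrite subrK.
have cB : babs c <= B.
  by rewrite ler_pdivlMr //; apply: le_trans (coord_bound Ws da Wx) xr.
split => //; last by exists c.
split => //; apply: le_trans (seminormB p_sn _ _) _.
by rewrite (seminormZ p_sn) lerD // ler_wpM2r // (seminorm_ge0 p_sn).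
Qed.

End TotalBoundedness.

(** * The quotient seminorm of a subspace *)

Section QuotientSeminorm.
Variables (R : realType) (b : base_field) (X : lmodType (base_fieldType R b)).
Variables (p : X -> R) (p_sn : seminorm p) (W : set X) (Ws : is_subspace W).

(** The distance to [W] is the seminorm of [X / W] read on [X], which avoids forming a quotient
    module. *)
Definition quot_seminorm (x : X) : R := inf [set p (x - w) | w in W].
Notation q := quot_seminorm.

Let has_inf_dist x : has_inf [set p (x - w) | w in W].
Proof.
split; first by exists (p (x - 0)), 0 => //; exact: subspace0.
by exists 0 => _ [w _ <-]; exact: seminorm_ge0.
Qed.

Lemma quot_seminorm_le x w : W w -> q x <= p (x - w).
Proof. by move=> Ww; apply: ge_inf; [case: (has_inf_dist x)|exists w]. Qed.

Lemma quot_seminorm_lt x r : q x < r -> exists2 w, W w & p (x - w) < r.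
Proof.
rewrite -subr_gt0 => /inf_adherent/(_ (has_inf_dist x))[_ [w Ww <-]].
by rewrite subrKC => lt; exists w.
Qed.

Lemma quot_seminorm_le_self x : q x <= p x.
Proof. by have := quot_seminorm_le x (subspace0 Ws); rewrite subr0. Qed.

Lemma quot_seminorm_ge0 x : 0 <= q x.
Proof.
by apply: lb_le_inf; [case: (has_inf_dist x)|move=> _ [w _ <-]; exact: seminorm_ge0].
Qed.

Lemma quot_seminorm_pclosure x : q x <= 0 -> pclosure p W x.
Proof. by move=> x0 e e0; apply: quot_seminorm_lt; apply: le_lt_trans x0 e0. Qed.

Lemma quot_seminormP : seminorm q.
Proof.
(* One inequality suffices: the reverse is this one at [c^-1] and [c *: x]. The summand 1 in
   [babs c + 1] covers [c = 0]. *)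
have qZ c x : q (c *: x) <= babs c * q x.
  apply/ler_addgt0Pr => e e0; have c1 : 0 < babs c + 1 by have := babs_ge0 c; lra.
  have [|w Ww lw] := @quot_seminorm_lt x (q x + e / (babs c + 1)).
    by rewrite ltrDl divr_gt0.
  apply: le_trans (quot_seminorm_le _ (subspaceZ c Ws Ww)) _.
  rewrite -scalerBr (seminormZ p_sn); have c0 := babs_ge0 c.
  apply: le_trans (ler_wpM2l c0 (ltW lw)) _.
  rewrite mulrDr lerD2l mulrA ler_pdivrMr //; nra.
split=> [x y|c x].
  apply/ler_addgt0Pr => e e0; have e2 : 0 < e / 2 by rewrite divr_gt0.
  have [|u Wu lu] := @quot_seminorm_lt x (q x + e / 2); first by rewrite ltrDl.
  have [|v Wv lv] := @quot_seminorm_lt y (q y + e / 2); first by rewrite ltrDl.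
  apply: le_trans (quot_seminorm_le _ (subspaceD Ws Wu Wv)) _.
  by rewrite opprD addrACA; have := seminormD p_sn (x - u) (y - v); lra.
apply/le_anti; rewrite qZ /=; have [->|c0] := eqVneq c 0.
  by rewrite babs0 mul0r quot_seminorm_ge0.
have b0 : 0 < babs c.
  rewrite lt_neqAle babs_ge0 andbT eq_sym.
  by apply: contra c0 => /eqP/babs_eq0 ->.
have := qZ c^-1 (c *: x); rewrite scalerA mulVf // scale1r babsV.
by rewrite ler_pdivlMl.
Qed.

End QuotientSeminorm.

Lemma invS_lt (R : realType) (e : R) : 0 < e ->
  exists N, forall n, (N <= n)%N -> n.+1%:R^-1 < e.
Proof.
move=> e0; exists (Num.trunc e^-1) => n Nn.
rewrite -[e]invrK ltf_pV2 ?posrE ?invr_gt0 ?ltr0n //.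
by apply: lt_le_trans (truncnS_gt _) _; rewrite ler_nat ltnS.
Qed.

(** * Cluster points and attraction *)

Section Attraction.
Variables (R : realType) (b : base_field) (X : lmodType (base_fieldType R b)).
Variables (p : X -> R) (p_sn : seminorm p).
Implicit Types (K : set X) (u : nat -> X).

Definition clusters_at u a := forall e : R, 0 < e ->
  forall N, exists2 n, (N <= n)%N & p (u n - a) < e.

(** Relative compactness in sequential form; the cluster point is allowed to lie outside [K]. *)
Definition seq_clustering K := forall u, (forall n, K (u n)) -> exists a, clusters_at u a.

Definition attracted u K := forall e : R, 0 < e ->
  forall N, exists n, (N <= n)%N /\ exists2 k, K k & p (u n - k) < e.

Lemma attracted_cluster u K : seq_clustering K -> attracted u K ->
  exists a, clusters_at u a.
Proof.
move=> Kcl uK.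
have /choice[f fP] : forall j : nat, exists nk : nat * X,
    [/\ (j <= nk.1)%N, K nk.2 & p (u nk.1 - nk.2) < j.+1%:R^-1].
  move=> j; have [|n [jn [k Kk lt]]] := uK j.+1%:R^-1 _ j; first by rewrite invr_gt0.
  by exists (n, k).
have [|a aP] := Kcl (fun j => (f j).2); first by move=> j; case: (fP j).
exists a => e e0 N; have e2 : 0 < e / 2 by rewrite divr_gt0.
have [M MP] := invS_lt e2.
have [j] := aP _ e2 (maxn N M); rewrite geq_max => /andP[Nj Mj] /= lt.
have [jf _ lt'] := fP j; exists (f j).1; first exact: leq_trans jf.
apply: le_lt_trans (seminorm_triangle p_sn (f j).2 _ _) _.
by rewrite [e]splitr ltrD // (lt_trans lt') // MP.
Qed.

Lemma attractedZ (c : R) u K : 0 < c -> attracted (fun n => of_base b c^-1 *: u n) K ->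
  attracted u [set of_base b c *: k | k in K].
Proof.
move=> c0 uK e e0 N; have [n [Nn [k Kk lt]]] := uK (e / c) (divr_gt0 e0 c0) N.
exists n; split=> //; exists (of_base b c *: k); first by exists k.
move: lt; rewrite ltr_pdivlMr // mulrC -(seminorm_normalize p_sn _ (ltW c0)) => lt.
by apply: le_lt_trans lt; rewrite scalerBr scalerA of_base_divff ?scale1r // gt_eqF.
Qed.

Lemma seq_clusteringZ c K : seq_clustering K -> seq_clustering [set c *: k | k in K].
Proof.
move=> Kcl u uK; have /choice[v vP] : forall n, exists k, K k /\ c *: k = u n.
  by move=> n; have [k Kk ku] := uK n; exists k.
have [|a aP] := Kcl v; first by move=> n; case: (vP n).
exists (c *: a) => e e0 N; have c1 : 0 < babs c + 1 by have := babs_ge0 c; lra.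
have [n Nn] := aP _ (divr_gt0 e0 c1) N; rewrite ltr_pdivlMr // => lt.
exists n => //; case: (vP n) => _ <-; rewrite -scalerBr (seminormZ p_sn).
have := seminorm_ge0 p_sn (v n - a); nra.
Qed.

End Attraction.

(** * Isometries with attracted orbits *)

Section AttractedIsometry.
Variables (R : realType) (b : base_field) (X : lmodType (base_fieldType R b)).
Variables (p : X -> R) (p_sn : seminorm p) (T : {linear X -> X}).

Lemma iter_linD n x y : iter n T (x + y) = iter n T x + iter n T y.
Proof. by elim: n => //= n ->; rewrite linearD. Qed.

Lemma iter_linB n x y : iter n T (x - y) = iter n T x - iter n T y.
Proof. by elim: n => //= n ->; rewrite linearB. Qed.

Hypothesis p_iso : forall x, p (T x) = p x.
Variable K : set X.
Hypothesis K_tb : tot_bounded p K.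
Hypothesis K_cluster : seq_clustering p K.
Hypothesis K_attr : forall x, p x < 1 -> attracted p (fun n => iter n T x) K.

Lemma seminorm_iter n x : p (iter n T x) = p x.
Proof. by elim: n => //= n <-. Qed.

(** Two iterates at times [n <= m] near one cluster point are near each other, and the isometry
    cancels [T^n], so [T^(m - n) x] is near [x]. *)
Lemma isometry_recurrent x e N : 0 < e ->
  exists2 m, (N <= m)%N & p (iter m T x - x) < e.
Proof.
move=> e0; have c1 : 0 < p x + 1 by have := seminorm_ge0 p_sn x; lra.
(* Attraction is assumed on the open unit ball only, so [x] is divided by [p x + 1] and [K] is
   enlarged by the same factor. *)
have [] := @attracted_cluster _ _ _ _ p_sn (fun n => iter n T x)
   [set of_base b (p x + 1) *: k | k in K].
- exact: seq_clusteringZ.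
- apply: attractedZ => //; have := @K_attr (of_base b (p x + 1)^-1 *: x).
  rewrite (seminorm_normalize p_sn) ?invr_ge0 ?(ltW c1) // mulrC ltr_pdivrMr //.
  have -> : (fun n => iter n T (of_base b (p x + 1)^-1 *: x)) =
            (fun n => of_base b (p x + 1)^-1 *: iter n T x).
    by apply/funext => n; rewrite iter_linZ.
  by apply; lra.
move=> a aP; have e2 : 0 < e / 2 by rewrite divr_gt0.
have [n _ n1] := aP _ e2 0; have [m nm m1] := aP _ e2 (n + N)%N.
exists (m - n)%N; first by rewrite leq_subRL ?(leq_trans (leq_addr _ _) nm).
rewrite -(seminorm_iter n) iter_linB -iterD subnKC ?(leq_trans (leq_addr _ _) nm) //.
have := seminorm_triangle p_sn a (iter m T x) (iter n T x).
by rewrite (seminorm_distC p_sn a); lra.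
Qed.

Definition orbit_tot_bounded : set X :=
  [set x | tot_bounded p (range (fun n => iter n T x))].
Notation Z := orbit_tot_bounded.

Lemma orbit_tot_bounded_iter n x : Z x -> Z (iter n T x).
Proof.
by apply: tot_bounded_sub => _ [m _ <-]; exists (m + n)%N; rewrite // iterD.
Qed.

Lemma orbit_tot_bounded_subspace : is_subspace Z.
Proof.
split=> [e e0|c u v Zu Zv].
  exists [:: 0] => _ [n _ <-]; exists 0; rewrite ?mem_seq1 //.
  by have := iter_linB n 0 0; rewrite !subrr => ->; rewrite subrr (seminorm0 p_sn).
apply: tot_bounded_sub (tot_boundedD p_sn (tot_boundedZ p_sn c Zu) Zv) => _ [n _ <-].
exists (c *: iter n T u), (iter n T v); split.
- by exists (iter n T u) => //; exists n.
- by exists n.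
- by rewrite iter_linD iter_linZ.
Qed.

Lemma orbit_tot_bounded_pclosure : pclosure p Z `<=` Z.
Proof.
move=> x cx e e0; have e2 : 0 < e / 2 by rewrite divr_gt0.
have [z Zz xz] := cx _ e2; have [s sP] := Zz _ e2.
exists s => _ [n _ <-]; have [|y ys zy] := sP (iter n T z); first by exists n.
exists y => //; have := seminorm_triangle p_sn (iter n T z) (iter n T x) y.
by rewrite -iter_linB seminorm_iter; lra.
Qed.

(* Each [x] in the unit ball of [Z] visits a net of [K] and comes back, hence is
   close to the orbit of one of finitely many vectors of [Z]. *)
Lemma orbit_tot_bounded_ball : ball_tot_bounded p Z.
Proof.
suff unit_ball : tot_bounded p [set x | Z x /\ p x < 1].
  move=> r; have r1 : 0 < `|r| + 1 by have := normr_ge0 r; lra.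
  apply: tot_bounded_sub (tot_boundedZ p_sn (of_base b (`|r| + 1)) unit_ball).
  move=> x [Zx xr]; exists (of_base b (`|r| + 1)^-1 *: x).
    split; first exact: subspaceZ orbit_tot_bounded_subspace Zx.
    rewrite (seminorm_normalize p_sn) ?invr_ge0 ?(ltW r1) // mulrC ltr_pdivrMr //.
    by have := ler_norm r; lra.
  by rewrite scalerA of_base_divff ?scale1r // gt_eqF.
move=> e e0; pose d := e / 6; have d0 : 0 < d by rewrite divr_gt0.
have [s sP] := K_tb d0.
(* [t a] is a net of the orbit of one reference vector passing within [2 * d] of [a]. By isometry,
   any other such orbit afterwards stays within [4 * d] of it, hence within [5 * d] of the net;
   recurrence adds the sixth [d]. *)
have /choice[t tP] : forall a : X, exists t : seq X, forall x n, Z x -> p x < 1 ->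
    p (iter n T x - a) < 2 * d -> forall m, (n <= m)%N ->
    exists2 y, y \in t & p (iter m T x - y) < 5 * d.
  move=> a.
  have [[x0 [n0 [Zx0 x01 lt0]]]|nex] := pselect (exists x n, [/\ Z x, p x < 1 &
    p (iter n T x - a) < 2 * d]); last first.
    by exists [::] => x n Zx x1 lt; case: nex; exists x, n.
  have [t tP] := orbit_tot_bounded_iter n0 Zx0 d0.
  exists t => x n Zx x1 lt m nm.
  have [|y yt ly] := tP (iter (m - n) T (iter n0 T x0)); first by exists (m - n)%N.
  exists y => //.
  have := seminorm_triangle p_sn (iter (m - n) T (iter n0 T x0)) (iter m T x) y.
  rewrite -[in iter m T x](subnK nm) iterD -iter_linB seminorm_iter.
  have := seminorm_triangle p_sn a (iter n T x) (iter n0 T x0).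
  by rewrite (seminorm_distC p_sn a); lra.
exists (flatten [seq t a | a <- s]) => x [Zx x1].
have [n [_ [k Kk lk]]] := K_attr x1 d0 0; have [a as_ la] := sP _ Kk.
have [m nm lm] := isometry_recurrent x n d0.
have [|y yt ly] := tP a x n Zx x1 _ m nm.
  by have := seminorm_triangle p_sn k (iter n T x) a; lra.
exists y; first by apply/flattenP; exists (t a) => //; exact: map_f.
have := seminorm_triangle p_sn (iter m T x) x y.
by rewrite (seminorm_distC p_sn x (iter m T x)); move: lm ly; rewrite /d; lra.
Qed.

Notation q := (quot_seminorm p Z).

Let Zs := orbit_tot_bounded_subspace.

(** [T] maps [Z] into itself, which bounds [q (T x)]. As [T] need not map onto [Z], the reverse
    bound replaces an element [w] of [Z] by a close iterate [T^(m + 1) w]. *)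
Lemma quot_isometry x : q (T x) = q x.
Proof.
apply/le_anti/andP; split; apply/ler_addgt0Pr => e e0.
  have [|w Zw lw] := @quot_seminorm_lt _ _ _ _ p_sn _ Zs x (q x + e); first by rewrite ltrDl.
  apply: le_trans (quot_seminorm_le p_sn Zs _ (orbit_tot_bounded_iter 1 Zw)) _.
  by rewrite /= -linearB p_iso ltW.
have e2 : 0 < e / 2 by rewrite divr_gt0.
have [|w Zw lw] := @quot_seminorm_lt _ _ _ _ p_sn _ Zs (T x) (q (T x) + e / 2).
  by rewrite ltrDl.
have [[//|m] _ lm] := isometry_recurrent w 1 e2.
apply: le_trans (quot_seminorm_le p_sn Zs _ (orbit_tot_bounded_iter m Zw)) _.
rewrite -p_iso linearB -iterS.
have := seminorm_triangle p_sn w (T x) (iter m.+1 T w).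
by rewrite (seminorm_distC p_sn w); lra.
Qed.

(* Approximate zeros of quadratic polynomials of the quotient isometry are moved
   by [T] close to [K], where they cluster at some [a]; boundedness of the
   coefficients is enough, they need not converge. *)
Lemma quotient_quadratic : (exists x, ~ Z x) -> exists2 a, ~ Z a &
  forall e : R, 0 < e -> exists c d, q (T (T a) + c *: T a + d *: a) < e.
Proof.
case=> x0 nZ.
have q_sn := quot_seminormP p_sn Zs.
have q0 : 0 < q x0.
  rewrite ltNge; apply/negP => /(quot_seminorm_pclosure p_sn Zs).
  by move/orbit_tot_bounded_pclosure.
have q_iter n x : q (iter n T x) = q x by elim: n => //= n <-; rewrite quot_isometry.
have /choice[f fP] : forall j : nat, exists yk : X * X, [/\ q yk.1 = 1 / 2,
    K yk.2, p (yk.1 - yk.2) < j.+1%:R^-1 &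
    exists c d, [/\ babs c <= 4, babs d <= 4 &
      q (T (T yk.1) + c *: T yk.1 + d *: yk.1) <= j.+1%:R^-1]].
  move=> j; have j0 : 0 < j.+1%:R^-1 :> R by rewrite invr_gt0.
  have [|c [d [c4 d4 [v v1 lv]]]] := approx_quadratic q_sn quot_isometry j0.
    by exists x0.
  (* Subtracting [z] brings [p] below [3 / 2] without changing [q]; halving then enters the open
     unit ball and fixes [q] at [1 / 2]. *)
  have [|z Zz lz] := @quot_seminorm_lt _ _ _ _ p_sn _ Zs v (3 / 2).
    by rewrite v1; lra.
  pose h := of_base b (1 / 2 : R); have half0 : 0 <= 1 / 2 :> R by lra.
  pose w := h *: (v - z).
  have w1 : p w < 1 by rewrite (seminorm_normalize p_sn _ half0); lra.
  have qh x : q (h *: x) = 1 / 2 * q x by exact: seminorm_normalize.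
  have qz x z' : Z z' -> q (x - z') = q x.
    move=> Zz'; have z0 : q z' = 0.
      apply/le_anti; rewrite (quot_seminorm_ge0 p_sn Zs) andbT.
      by have := quot_seminorm_le p_sn Zs z' Zz'; rewrite subrr (seminorm0 p_sn).
    apply/le_anti; have := seminormB q_sn x z'.
    by have := seminormD q_sn (x - z') z'; rewrite subrK z0; lra.
  have [n [_ [k Kk lk]]] := K_attr w1 j0 0.
  exists (iter n T w, k); split => //=.
    by rewrite q_iter qh qz // v1 mulr1.
  exists c, d; split => //.
  pose Q u := T (T u) + c *: T u + d *: u.
  have QT m u : Q (iter m T u) = iter m T (Q u).
    elim: m => //= m <-; rewrite /Q ![T (_ + _)]linearD /= ![T (_ *: _)]linearZ //.
  have QB u u' : Q (u - u') = Q u - Q u'.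
    rewrite /Q ![T (_ - _)]linearB /= !scalerBr !opprD.
    by rewrite [RHS]addrACA [X in _ = X + _]addrACA.
  have QZ u : Q (h *: u) = h *: Q u.
    by rewrite /Q ![T (_ *: _)]linearZ /= !scalerDr !scalerA !(mulrC _ h).
  rewrite -/(Q _) QT q_iter QZ qh QB qz; first by move: lv; rewrite -/(Q v); move: (j.+1%:R^-1 : R) j0 => i i0; lra.
  have ZTi m := orbit_tot_bounded_iter m Zz.
  apply: (subspaceD Zs (subspaceD Zs (ZTi 2%N) _)).
    exact: (subspaceZ c Zs (ZTi 1%N)).
  exact: (subspaceZ d Zs Zz).
have [|a aP] := @K_cluster (fun j => (f j).2); first by move=> j; case: (fP j).
have close e : 0 < e -> exists y c d, [/\ q y = 1 / 2, p (y - a) < e,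
    babs c <= 4, babs d <= 4 & q (T (T y) + c *: T y + d *: y) < e].
  move=> e0; have e2 : 0 < e / 2 by rewrite divr_gt0.
  have [M MP] := invS_lt e2; have [j Mj lj] := aP _ e2 M.
  have [y1 Ky lt [c [d [c4 d4 lq]]]] := fP j; move: (MP _ Mj) lt lq.
  move: (j.+1%:R^-1 : R) => i lM lt lq.
  exists (f j).1, c, d; split => //; last by lra.
  by have := seminorm_triangle p_sn (f j).2 (f j).1 a; lra.
exists a.
  (* If [a] were in [Z], then [1 / 2 = q y <= p (y - a) < 1 / 2]. *)
  have [|y [c [d [y2 ya _ _ _]]]] := close (1 / 2); first by lra.
  move=> Za; have := quot_seminorm_le p_sn Zs y Za; lra.
(* The coefficients are at most 4, so replacing [y] by [a] costs at most nine tenths of [e], and the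
   quadratic at [y] less than the last tenth. *)
move=> e e0; have e10 : 0 < e / 10 by rewrite divr_gt0.
have [y [c [d [y2 ya c4 d4 lq]]]] := close _ e10; exists c, d.
have := seminorm_le_dist q_sn (T (T a) + c *: T a + d *: a) (T (T y) + c *: T y + d *: y).
have -> : T (T a) + c *: T a + d *: a - (T (T y) + c *: T y + d *: y) =
   T (T (a - y)) + c *: T (a - y) + d *: (a - y).
  rewrite ![T (_ - _)]linearB /= !scalerBr !opprD.
  by rewrite [LHS]addrACA [X in X + _ = _]addrACA.
have := seminormD q_sn (T (T (a - y)) + c *: T (a - y)) (d *: (a - y)).
have := seminormD q_sn (T (T (a - y))) (c *: T (a - y)).
rewrite !(seminormZ q_sn) !quot_isometry.
have l1 : q (a - y) < e / 10.
  by apply: le_lt_trans (quot_seminorm_le_self p_sn Zs _) _; rewrite (seminorm_distC p_sn).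
have := quot_seminorm_ge0 p_sn Zs (a - y).
have := babs_ge0 c; have := babs_ge0 d; nra.
Qed.

Lemma ball_tot_bounded_setT : ball_tot_bounded p setT.
Proof.
suff ZT x : Z x by apply: ball_tot_bounded_sub orbit_tot_bounded_ball => x _.
apply: contrapT => nZx; have [|a nZa aP] := quotient_quadratic; first by exists x.
apply: nZa; pose W := addline (addline Z a) (T a).
have Was : is_subspace (addline Z a) by exact: addline_subspace.
have Ws : is_subspace W by exact: addline_subspace.
have tW : ball_tot_bounded p (pclosure p W).
  apply: ball_tot_bounded_pclosure => //; do 2 apply: ball_tot_bounded_addline => //.
  exact: orbit_tot_bounded_ball.
have Wa : W a by apply: sub_addline; exact: addline_self.
have WTa : W (T a) by exact: addline_self.
have ZW z : Z z -> W z by move=> Zz; do 2 apply: sub_addline.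
(* The coefficients change with [e], but the approximants they produce always stay in [W]. *)
have cWTT : pclosure p W (T (T a)).
  move=> e e0; have [c [d lt]] := aP _ e0.
  have [w Zw lw] := quot_seminorm_lt p_sn Zs lt.
  exists (w - d *: a - c *: T a).
    by do 2 (apply: subspaceB => //; last exact: subspaceZ); exact: ZW.
  suff <- : T (T a) + c *: T a + d *: a - w = T (T a) - (w - d *: a - c *: T a) by [].
  by rewrite !opprB !addrA.
have TW w : W w -> pclosure p W (T w).
  move=> [c [d Zw]] e e0.
  have c1 : 0 < babs c + 1 by have := babs_ge0 c; lra.
  have [v Wv] := cWTT _ (divr_gt0 e0 c1); rewrite ltr_pdivlMr // => lv.
  pose z := w - c *: T a - d *: a.
  exists (T z + d *: T a + c *: v).
    apply: subspaceD => //; last exact: subspaceZ.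
    apply: subspaceD => //; last exact: subspaceZ.
    by apply: ZW; exact: (orbit_tot_bounded_iter 1 Zw).
  have -> : T w - (T z + d *: T a + c *: v) = c *: (T (T a) - v).
    have -> : w = z + d *: a + c *: T a by rewrite /z !subrK.
    rewrite ![T (_ + _)]linearD /= ![T (_ *: _)]linearZ /= scalerBr.
    by rewrite opprD addrACA subrr add0r.
  rewrite (seminormZ p_sn); have := seminorm_ge0 p_sn (T (T a) - v); nra.
have TcW w : pclosure p W w -> pclosure p W (T w).
  move=> cw; apply: pclosureK => // e e0; have [v Wv lv] := cw _ e0.
  by exists (T v); [exact: TW|rewrite -linearB p_iso].
have orb n : pclosure p W (iter n T a).
  by elim: n => [|n IH]; [exact: sub_pclosure|exact: TcW].
(* The orbit of [a] stays in the closure of [W] at constant [p], hence in a totally bounded ball. *)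
apply: tot_bounded_sub (tW (p a)) => _ [n _ <-].
by split => //; rewrite seminorm_iter.
Qed.

End AttractedIsometry.

(** * Norms, limits and completeness read in the reals *)

Section NormReading.
Variables (R : realType) (b : base_field).
Notation F := (base_fieldType R b).

Section NormedModule.
Variable X : normedModType F.

Lemma rnorm_seminorm : seminorm (@rnorm R b X).
Proof.
split=> [x y|c x]; first by rewrite /rnorm -base_reD; apply/base_re_le/ler_normD.
by rewrite /rnorm normrZ base_reM.
Qed.

Lemma rnorm_lt (x : X) (e : F) : 0 < e -> (rnorm x < base_re e) = (`|x| < e).
Proof. by move=> e0; rewrite /rnorm base_re_lt // ltW. Qed.

Lemma rnorm_eq0 (x : X) : rnorm x = 0 -> x = 0.
Proof.
move=> /(congr1 (of_base b)); rewrite base_reK // => x0; apply/normr0_eq0.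
by rewrite x0 /of_base; case: (b).
Qed.

Lemma cvg_rnorm (u : nat -> X) l : u @ \oo --> l <->
  forall e : R, 0 < e -> exists N, forall n, (N <= n)%N -> rnorm (u n - l) < e.
Proof.
rewrite cvgrPdistC_lt; split=> [ul e e0|ul e e0].
  have [N _ NP] := ul _ (of_base_gt0 b e0); exists N => n Nn.
  by rewrite -(of_baseK b e) rnorm_lt ?of_base_gt0 //; exact: NP.
have [N NP] := ul _ (base_re_gt0 e0).
by exists N => // n /= Nn; rewrite -rnorm_lt //; exact: NP.
Qed.

Lemma compact_seq_clustering (K : set X) : compact K -> seq_clustering (@rnorm R b X) K.
Proof.
move=> cK u uK; have [|a [Ka aP]] := cK (u @ \oo) _; first by exists 0%N => // n _; exact: uK.
exists a => e e0 N.
have [||x [[n /= Nn <-] xa]] := aP (u @` [set n | (N <= n)%N]) (ball a (of_base b e)).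
- by exists N => // n Nn; exists n.
- exact/nbhsx_ballx/of_base_gt0.
exists n => //; rewrite -(of_baseK b e) rnorm_lt ?of_base_gt0 //.
by move: xa; rewrite -ball_normE /= distrC.
Qed.

End NormedModule.

Lemma rnorm_complete (X : completeNormedModType F) (u : nat -> X) :
  (forall e : R, 0 < e -> exists N, forall m n, (N <= m)%N -> (N <= n)%N ->
    rnorm (u m - u n) < e) ->
  exists l, forall e : R, 0 < e -> exists N, forall n, (N <= n)%N -> rnorm (u n - l) < e.
Proof.
move=> uC; suff /cvg_ex[l] : cvgn u by move/cvg_rnorm => ul; exists l.
apply/cauchy_cvgP/cauchyP => e e0.
have [N NP] := uC _ (base_re_gt0 e0).
exists (u N); exists N => // n /= Nn.
by rewrite -ball_normE /= -rnorm_lt //; exact: NP.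
Qed.

(** The tail infima [einfs u] increase to the lower limit; being nonnegative, they vanish when that
    limit does. *)
Lemma limn_einf_eq0 (u : nat -> \bar R) : (forall n, 0 <= u n)%E ->
  limn_einf u = 0%E <->
  forall e : R, 0 < e -> forall N, exists2 n, (N <= n)%N & (u n < e%:E)%E.
Proof.
move=> u0; rewrite limn_einf_lim; split=> [lim0 e e0 N|h].
  have : (einfs u N < e%:E)%E.
    apply: le_lt_trans (_ : 0 < e%:E)%E; last by rewrite lte_fin.
    rewrite -lim0 (cvg_lim _ (@cvg_einfs_sup _ u)) //.
    by apply: ereal_sup_ubound; exists N.
  by move=> /ereal_inf_lt[_ [n /= Nn <-] lt]; exists n.
suff -> : einfs u = cst 0%E by rewrite lim_cst.
apply/funext => N; apply/le_anti/andP; split.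
  apply/lee_addgt0Pr => e e0; rewrite add0e; have [n Nn lt] := h e e0 N.
  by apply: le_trans (ltW lt); apply: ereal_inf_lbound; exists n.
by apply: le_ereal_inf_tmp => _ [n _ <-].
Qed.

End NormReading.

Lemma babs_complete (R : realType) (b : base_field) (u : nat -> base_fieldType R b) :
  (forall e : R, 0 < e -> exists N, forall m n, (N <= m)%N -> (N <= n)%N ->
    babs (u m - u n) < e) ->
  exists l, forall e : R, 0 < e -> exists N, forall n, (N <= n)%N -> babs (u n - l) < e.
Proof.
have real_complete (v : nat -> R) :
    (forall e : R, 0 < e -> exists N, forall m n, (N <= m)%N -> (N <= n)%N ->
      `|v m - v n| < e) ->
    exists l, forall e : R, 0 < e -> exists N, forall n, (N <= n)%N -> `|v n - l| < e.
  exact: (@rnorm_complete R OverReal R).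
case: b u; first exact: real_complete.
move=> u uC.
have le2 (z : R[i]) : `|complex.Re z| <= @babs R OverComplex z /\
    `|complex.Im z| <= @babs R OverComplex z.
  rewrite /babs normc_def /= -!sqrtr_sqr.
  by split; rewrite ler_wsqrtr // ?lerDl ?lerDr sqr_ge0.
have [|x xP] := real_complete (fun n => complex.Re (u n)).
  move=> e e0; have [N NP] := uC e e0; exists N => m n Nm Nn.
  rewrite -raddfB /=; apply: le_lt_trans (NP _ _ Nm Nn); exact: (le2 _).1.
have [|y yP] := real_complete (fun n => complex.Im (u n)).
  move=> e e0; have [N NP] := uC e e0; exists N => m n Nm Nn.
  rewrite -raddfB /=; apply: le_lt_trans (NP _ _ Nm Nn); exact: (le2 _).2.
exists (x +i* y)%C => e e0; have e2 : 0 < e / 2 by rewrite divr_gt0.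
have [N NP] := xP _ e2; have [M MP] := yP _ e2.
exists (maxn N M) => n; rewrite geq_max => /andP[/NP hx /MP hy].
have -> : u n - (x +i* y)%C = ((complex.Re (u n) - x) +i* (complex.Im (u n) - y))%C by case: (u n).
rewrite /babs normc_def /=.
have -> : e = Num.sqrt (e ^+ 2) by rewrite sqrtr_sqr gtr0_norm.
rewrite ltr_sqrt ?exprn_gt0 //.
rewrite -(real_normK (num_real (complex.Re _ - _))) -(real_normK (num_real (complex.Im _ - _))).
have := normr_ge0 (complex.Re (u n) - x); have := normr_ge0 (complex.Im (u n) - y); nra.
Qed.

(** * Finite spans *)

Section LinearSpans.
Variables (F : fieldType) (X : lmodType F).

(** Adding one line at a time suits inductions on the generators. *)
Fixpoint seq_span (s : seq X) : set X :=
  if s is a :: s' then addline (seq_span s') a else [set 0].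

Lemma seq_span_subspace s : is_subspace (seq_span s).
Proof.
elim: s => [|a s IH] /=; last exact: addline_subspace.
by split => // k u v -> ->; rewrite scaler0 addr0.
Qed.

Lemma mem_seq_span s a : a \in s -> seq_span s a.
Proof.
elim: s => //= c s IH; rewrite inE => /predU1P[->|/IH].
  exact/addline_self/seq_span_subspace.
exact: sub_addline.
Qed.

Lemma linspan_subset (A L : set X) : is_subspace L -> A `<=` L -> linspan A `<=` L.
Proof.
move=> Ls AL _ [n [c [a [Aa ->]]]].
elim/big_ind: _ => [|u v|i _]; [exact: subspace0|exact: subspaceD|].
by apply: subspaceZ => //; exact: AL.
Qed.

Lemma sub_linspan (A : set X) : A `<=` linspan A.
Proof.
move=> x Ax; exists 1%N, (fun=> 1), (fun=> x).
by rewrite big_ord1 scale1r.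
Qed.

Lemma linspan_mono (A B : set X) : A `<=` B -> linspan A `<=` linspan B.
Proof.
by move=> AB _ [n [c [a [Aa ->]]]]; exists n, c, a; split => // i; exact: AB.
Qed.

Lemma linspan_cons (A : set X) c a x : A a -> linspan A x -> linspan A (c *: a + x).
Proof.
move=> Aa [n [d [v [Av ->]]]].
exists n.+1, (fun i => oapp d c (unlift ord0 i)), (fun i => oapp v a (unlift ord0 i)).
split; first by move=> i; case: (unlift ord0 i).
by rewrite big_ord_recl unlift_none; congr (_ + _); apply: eq_bigr => i _; rewrite liftK.
Qed.

Lemma seq_span_linspan s : seq_span s `<=` linspan [set` s].
Proof.
elim: s => [|a s IH] x /=.
  by move=> ->; exists 0%N, (fun=> 0), (fun=> 0); rewrite big_ord0; split=> // -[].
case=> c /IH lx; rewrite -(subrKC (c *: a) x).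
apply: linspan_cons; first by rewrite /= mem_head.
by apply: linspan_mono lx => y /= ys; rewrite inE ys orbT.
Qed.

End LinearSpans.

(** * Finite dimension from totally bounded balls *)

Section SeminormSpans.
Variables (R : realType) (b : base_field) (X : lmodType (base_fieldType R b)).
Variables (p : X -> R) (p_sn : seminorm p).

(** Without a finite [e]-net, a greedy choice gives a sequence with mutual distances at least [e],
    which cannot cluster. *)
Lemma seq_clustering_tot_bounded (K : set X) : seq_clustering p K -> tot_bounded p K.
Proof.
move=> Kcl e e0; apply: contrapT => ns.
have /choice[g gP] : forall s : seq X, exists x, K x /\ forall y, y \in s -> e <= p (x - y).
  move=> s; apply: contrapT => nx; apply: ns; exists s => x Kx; apply: contrapT => ny.
  apply: nx; exists x; split => // y ys; rewrite leNgt; apply/negP => lt.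
  by apply: ny; exists y.
pose l := fix l n := if n is n'.+1 then g (l n') :: l n' else [::].
have lP m n : (m < n)%N -> g (l m) \in l n.
  elim: n => // n IH; rewrite ltnS leq_eqVlt => /predU1P[->|/IH h] /=.
    exact: mem_head.
  by rewrite inE h orbT.
have [|a aP] := Kcl (fun n => g (l n)); first by move=> n; case: (gP (l n)).
have e2 : 0 < e / 2 by rewrite divr_gt0.
have [n _ ln] := aP _ e2 0%N; have [m nm lm] := aP _ e2 n.+1.
have := (gP (l m)).2 _ (lP _ _ nm); rewrite /= in ln lm.
have := seminorm_triangle p_sn a (g (l m)) (g (l n)).
by rewrite (seminorm_distC p_sn a); lra.
Qed.

(* Completeness of the scalars makes finitely generated subspaces closed. *)
Lemma seq_span_pclosed s x : pclosure p (seq_span s) x ->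
  exists2 y, seq_span s y & p (x - y) = 0.
Proof.
elim: s x => [|a s IH] x cx.
  exists 0 => //; apply/le_anti; rewrite (seminorm_ge0 p_sn) andbT.
  apply/ler_addgt0Pr => e e0; rewrite add0r.
  by have [_ ->] := cx e e0; exact: ltW.
have Ws := seq_span_subspace s.
have [ca|/not_pclosure[d d0 da]] := pselect (pclosure p (seq_span s) a).
  have [|y Wy xy] := IH x; last by exists y => //; exact: sub_addline.
  apply: pclosureK => // e e0; have [w Ww xw] := cx e e0.
  by exists w => //; apply: addline_sub_pclosure Ww.
have /choice[v vP] : forall j : nat, exists vc : X * base_fieldType R b,
    seq_span s (vc.1 - vc.2 *: a) /\ p (x - vc.1) < j.+1%:R^-1.
  move=> j; have [|w [c Wc] lw] := cx j.+1%:R^-1; first by rewrite invr_gt0.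
  by exists (w, c).
have small e : 0 < e -> exists N, forall n, (N <= n)%N -> p (x - (v n).1) < e.
  move=> /invS_lt[N NP]; exists N => n Nn.
  exact: lt_trans (vP n).2 (NP n Nn).
have [|c cP] := @babs_complete R b (fun n => (v n).2).
  move=> e e0; have [|N NP] := small (e * d / 2); first by rewrite divr_gt0 // mulr_gt0.
  exists N => m n Nm Nn.
  have Wmn : seq_span s ((v m).1 - (v n).1 - ((v m).2 - (v n).2) *: a).
    rewrite scalerBl opprD addrACA -opprD.
    by apply: subspaceB => //; case: (vP m); case: (vP n).
  have := coord_bound p_sn Ws da Wmn.
  have := seminorm_triangle p_sn x (v m).1 (v n).1; rewrite (seminorm_distC p_sn _ x).
  have := NP _ Nm; have := NP _ Nn => ln lm tri cb.
  by rewrite -(ltr_pM2r d0); lra.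
have [|y Wy xy] := IH (x - c *: a).
  move=> e e0; have a1 : 0 < p a + 1 by have := seminorm_ge0 p_sn a; lra.
  have e2 : 0 < e / 2 by rewrite divr_gt0.
  have [N NP] := small _ e2; have [M MP] := cP _ (divr_gt0 e2 a1).
  pose n := maxn N M; have ln := NP n (leq_maxl _ _); have := MP n (leq_maxr _ _).
  rewrite ltr_pdivlMr // => lc.
  exists ((v n).1 - (v n).2 *: a); first by case: (vP n).
  have -> : x - c *: a - ((v n).1 - (v n).2 *: a) = (x - (v n).1) + ((v n).2 - c) *: a.
    by rewrite scalerBl opprD addrACA opprK [- _ + _]addrC.
  have := seminormD p_sn (x - (v n).1) (((v n).2 - c) *: a); rewrite (seminormZ p_sn).
  have := babs_ge0 ((v n).2 - c); nra.
exists (y + c *: a); last by rewrite opprD addrA addrAC.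
by exists c; rewrite addrK.
Qed.

(* A finite [1/2]-net of the unit ball spans (Riesz). *)
Lemma ball_tot_bounded_finite_dim : ball_tot_bounded p setT ->
  exists s : seq X, forall x, exists2 y, seq_span s y & p (x - y) = 0.
Proof.
move=> tb; have half0 : 0 < 1 / 2 :> R by lra.
have [s sP] := tb 1 _ half0; exists s => x; apply: seq_span_pclosed.
have Ws := seq_span_subspace s.
(* A net point near the normalized [z], scaled back, halves [p z]. Hence the distance from [x] to
   the span is at most half of itself, so it is zero. *)
have half z : exists2 y, seq_span s y & p (z - y) <= p z / 2.
  have [z0|z0] := eqVneq (p z) 0.
    by exists 0; [exact: subspace0|rewrite subr0 z0 mul0r].
  have zp : 0 < p z by rewrite lt_neqAle eq_sym z0 (seminorm_ge0 p_sn).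
  have [|y ys ly] := sP (of_base b (p z)^-1 *: z).
    by split => //; rewrite (seminorm_normalize p_sn) ?invr_ge0 ?(ltW zp) // mulVf.
  exists (of_base b (p z) *: y).
    by apply: subspaceZ => //; exact: mem_seq_span.
  have zE : of_base b (p z) *: (of_base b (p z)^-1 *: z) = z.
    by rewrite scalerA of_base_divff // scale1r.
  rewrite -[X in p (X - _)]zE -scalerBr (seminorm_normalize p_sn _ (ltW zp)).
  by rewrite ler_pM2l //; lra.
apply: (quot_seminorm_pclosure p_sn Ws); apply/ler_addgt0Pr => e e0; rewrite add0r.
have [|w Ww lw] := @quot_seminorm_lt _ _ _ _ p_sn _ Ws x (quot_seminorm p (seq_span s) x + e).
  by rewrite ltrDl.
have [y Wy ly] := half (x - w).
have := quot_seminorm_le p_sn Ws x (subspaceD Ws Ww Wy).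
by rewrite opprD addrA; lra.
Qed.

End SeminormSpans.

(** * The limsup seminorm of a power bounded operator *)

Section PowerBounded.
Variables (R : realType) (b : base_field) (X : completeNormedModType (base_fieldType R b)).
Variable T : {linear X -> X}.

Notation nrm := (@rnorm R b X).
Let n_sn : seminorm nrm := rnorm_seminorm X.

Lemma power_bounded_bound : power_bounded T ->
  exists2 M : R, 0 < M & forall n x, rnorm (iter n T x) <= M * rnorm x.
Proof.
rewrite /power_bounded; set B := ereal_sup _ => Boo.
have le n x : rnorm x <= 1 -> ((rnorm (iter n T x))%:E <= B)%E.
  move=> x1; apply: (@le_trans _ _ (opnorm (iter n T))).
    by apply: ereal_sup_ubound; exists x.
  by apply: ereal_sup_ubound; exists n.
have B0 : (0%:E <= B)%E.
  by have := le 0%N 0; rewrite /= (seminorm0 n_sn); apply.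
have [r BE] : exists r, B = r%:E by case: (B) Boo B0 => // r _ _; exists r.
rewrite BE lee_fin in B0; exists (r + 1); first by lra.
move=> n x; have [x0|x0] := eqVneq (rnorm x) 0.
  have := iter_linB T n 0 0; rewrite !subrr (rnorm_eq0 x0) => ->.
  by rewrite (seminorm0 n_sn) mulr0.
have xp : 0 < rnorm x by rewrite lt_neqAle eq_sym x0 (seminorm_ge0 n_sn).
have := le n (of_base b (rnorm x)^-1 *: x).
rewrite iter_linZ !(seminorm_normalize n_sn) ?invr_ge0 ?(ltW xp) // mulVf // BE lee_fin.
by move=> /(_ (lexx _)); rewrite ler_pdivrMl // => h; rewrite mulrC mulrDr; lra.
Qed.

Lemma rdist_ge0 x (Y : set X) : (0 <= rdist x Y)%E.
Proof.
by apply: le_ereal_inf_tmp => _ [y _ <-]; rewrite lee_fin (seminorm_ge0 n_sn).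
Qed.

Lemma attracted_rdist (K : set X) x :
  limn_einf (fun n => rdist (iter n T x) K) = 0%E ->
  attracted nrm (fun n => iter n T x) K.
Proof.
move=> /limn_einf_eq0 h e e0 N; have [|n Nn] := h _ e e0 N.
  by move=> n; exact: rdist_ge0.
by move=> /ereal_inf_lt[_ [k Kk <-]]; rewrite lte_fin => lt; exists n; split => //; exists k.
Qed.

Lemma returningP a : returning T a <-> clusters_at nrm (fun n => iter n T a) a.
Proof.
rewrite /returning /= limn_einf_eq0; last by move=> n; rewrite lee_fin (seminorm_ge0 n_sn).
by split=> h e e0 N; have [n Nn lt] := h e e0 N; exists n => //; rewrite ?lte_fin // -lte_fin.
Qed.

Variables (M : R) (M0 : 0 < M).
Hypothesis TM : forall n x, rnorm (iter n T x) <= M * rnorm x.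

(** The infimum of the eventual upper bounds is the limsup of the norms, a real number because
    orbits are bounded. *)
Definition limsup_seminorm (x : X) : R :=
  inf [set r | exists N, forall n, (N <= n)%N -> rnorm (iter n T x) <= r].
Notation p := limsup_seminorm.

Let has_inf_ev x :
  has_inf [set r | exists N, forall n, (N <= n)%N -> rnorm (iter n T x) <= r].
Proof.
split; first by exists (M * rnorm x), 0%N.
by exists 0 => r [N /(_ _ (leqnn N))]; apply: le_trans; exact: seminorm_ge0.
Qed.

Lemma limsup_seminorm_le x r N :
  (forall n, (N <= n)%N -> rnorm (iter n T x) <= r) -> p x <= r.
Proof. by move=> h; apply: ge_inf; [case: (has_inf_ev x)|exists N]. Qed.

Lemma limsup_seminorm_lt x r : p x < r ->
  exists N, forall n, (N <= n)%N -> rnorm (iter n T x) < r.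
Proof.
rewrite -subr_gt0 => /inf_adherent/(_ (has_inf_ev x))[r' [N NP]].
by rewrite subrKC => lt; exists N => n /NP; move=> /le_lt_trans; apply.
Qed.

Lemma limsup_seminormP : seminorm p.
Proof.
have pZ c x : p (c *: x) <= babs c * p x.
  apply/ler_addgt0Pr => e e0; have c1 : 0 < babs c + 1 by have := babs_ge0 c; lra.
  have [|N NP] := @limsup_seminorm_lt x (p x + e / (babs c + 1)).
    by rewrite ltrDl divr_gt0.
  apply: (@limsup_seminorm_le _ _ N) => n /NP/ltW lt.
  rewrite iter_linZ (seminormZ n_sn); have c0 := babs_ge0 c.
  apply: le_trans (ler_wpM2l c0 lt) _.
  by rewrite mulrDr lerD2l mulrA ler_pdivrMr //; nra.
have p0 x : 0 <= p x.
  apply: lb_le_inf; first by case: (has_inf_ev x).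
  by move=> r [N /(_ _ (leqnn N))]; apply: le_trans; exact: seminorm_ge0.
split=> [x y|c x].
  apply/ler_addgt0Pr => e e0; have e2 : 0 < e / 2 by rewrite divr_gt0.
  have [|N NP] := @limsup_seminorm_lt x (p x + e / 2); first by rewrite ltrDl.
  have [|N' NP'] := @limsup_seminorm_lt y (p y + e / 2); first by rewrite ltrDl.
  apply: (@limsup_seminorm_le _ _ (maxn N N')) => n.
  rewrite geq_max => /andP[/NP hx /NP' hy]; rewrite iter_linD.
  by have := seminormD n_sn (iter n T x) (iter n T y); lra.
apply/le_anti; rewrite pZ /=; have [->|c0] := eqVneq c 0.
  by rewrite babs0 mul0r p0.
have b0 : 0 < babs c.
  rewrite lt_neqAle babs_ge0 andbT eq_sym.
  by apply: contra c0 => /eqP/babs_eq0 ->.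
have := pZ c^-1 (c *: x); rewrite scalerA mulVf // scale1r babsV.
by rewrite ler_pdivlMl.
Qed.

Let p_sn := limsup_seminormP.

Lemma limsup_seminorm_iso x : p (T x) = p x.
Proof.
apply/le_anti/andP; split; apply/ler_addgt0Pr => e e0.
  have [|N NP] := @limsup_seminorm_lt x (p x + e); first by rewrite ltrDl.
  apply: (@limsup_seminorm_le _ _ N) => n Nn.
  by rewrite -iterSr; apply/ltW/NP/leqW.
have [|N NP] := @limsup_seminorm_lt (T x) (p (T x) + e); first by rewrite ltrDl.
apply: (@limsup_seminorm_le _ _ N.+1) => -[//|n] Nn.
by rewrite iterSr; exact/ltW/NP.
Qed.

Lemma limsup_seminorm_le_norm x : p x <= M * rnorm x.
Proof. by apply: (@limsup_seminorm_le _ _ 0) => n _. Qed.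

Lemma limsup_seminorm_eq0 x : p x = 0 <-> iter n T x @[n --> \oo] --> (0 : X).
Proof.
rewrite cvg_rnorm; split=> [x0 e e0|h].
  have [|N NP] := @limsup_seminorm_lt x e; first by rewrite x0.
  by exists N => n; rewrite subr0; exact: NP.
apply/le_anti; rewrite (seminorm_ge0 p_sn) andbT; apply/ler_addgt0Pr => e e0.
have [N NP] := h e e0; rewrite add0r; apply: (@limsup_seminorm_le _ _ N) => n Nn.
by have := NP n Nn; rewrite subr0 => /ltW.
Qed.

(** At late return times [T^n a] is close to [a] and its norm barely exceeds [p a]. On returning
    vectors, estimates in [p] thus become estimates in norm. *)
Lemma returning_le a : returning T a -> rnorm a <= p a.
Proof.
move=> /returningP ra; apply/ler_addgt0Pr => e e0.
have e2 : 0 < e / 2 by rewrite divr_gt0.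
have [|N NP] := @limsup_seminorm_lt a (p a + e / 2); first by rewrite ltrDl.
have [n /NP l1 l2] := ra _ e2 N.
have := seminorm_le_dist n_sn a (iter n T a); rewrite (seminorm_distC n_sn a); lra.
Qed.

(** The difference has the return times of [a], since [T^m - T^m'] commutes with iterates and is
    bounded by [2 * M]. This precedes, and serves to prove, that returning vectors form a
    subspace. *)
Lemma returning_iterB a m m' : returning T a -> returning T (iter m T a - iter m' T a).
Proof.
move=> /returningP ra; apply/returningP => e e0 N.
have M2 : 0 < 2 * M by rewrite mulr_gt0.
have [n Nn] := ra _ (divr_gt0 e0 M2) N; rewrite ltr_pdivlMr // => lt.
exists n => //.
have -> : iter n T (iter m T a - iter m' T a) - (iter m T a - iter m' T a) =
    iter m T (iter n T a - a) - iter m' T (iter n T a - a).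
  by rewrite !iter_linB -!iterD ![(n + _)%N]addnC !opprD addrACA.
have := seminormB n_sn (iter m T (iter n T a - a)) (iter m' T (iter n T a - a)).
have := TM m (iter n T a - a); have := TM m' (iter n T a - a); lra.
Qed.

Lemma returning_iter a m : returning T a -> returning T (iter m T a).
Proof.
move=> /returningP ra; apply/returningP => e e0 N.
have [n Nn] := ra _ (divr_gt0 e0 M0) N; rewrite ltr_pdivlMr // => lt.
exists n => //; rewrite -iterD addnC iterD -iter_linB.
by have := TM m (iter n T a - a); lra.
Qed.

Lemma returning_closed a :
  (forall e : R, 0 < e -> exists2 c, returning T c & rnorm (a - c) < e) -> returning T a.
Proof.
move=> h; apply/returningP => e e0 N.
have e2 : 0 < e / 2 by rewrite divr_gt0.
have [c /returningP rc] := h _ (divr_gt0 e2 (addr_gt0 M0 ltr01)).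
rewrite ltr_pdivlMr ?addr_gt0 // => lt.
have [n Nn ln] := rc _ e2 N; exists n => //.
have := seminorm_triangle n_sn (iter n T c) (iter n T a) a.
have := seminorm_triangle n_sn c (iter n T c) a; rewrite -iter_linB.
have := TM n (a - c); rewrite (seminorm_distC n_sn c a); lra.
Qed.

(** * Returning vectors under attraction to a compact set *)

Variables (K : set X) (K_compact : compact K).
Hypothesis K_attr : forall x : X, rnorm x <= 1 ->
  limn_einf (fun n => rdist (iter n T x) K) = 0%E.

Let norm_attracted x : rnorm x <= 1 -> attracted nrm (fun n => iter n T x) K.
Proof. by move=> /K_attr/attracted_rdist. Qed.

Let limsup_clustering : seq_clustering p K.
Proof.
move=> u /(compact_seq_clustering K_compact)[a aP]; exists a => e e0 N.
have [n Nn] := aP _ (divr_gt0 e0 M0) N; rewrite ltr_pdivlMr // => lt.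
by exists n => //; apply: le_lt_trans (limsup_seminorm_le_norm _) _; rewrite mulrC.
Qed.

Let limsup_attracted x : p x < 1 -> attracted p (fun n => iter n T x) K.
Proof.
move=> /limsup_seminorm_lt[m /(_ _ (leqnn m))/ltW x1] e e0 N.
have [n [Nn [k Kk]]] := norm_attracted x1 (divr_gt0 e0 M0) N.
rewrite ltr_pdivlMr // -iterD => lt; exists (n + m)%N; split.
  exact: leq_trans Nn (leq_addr _ _).
by exists k => //; apply: le_lt_trans (limsup_seminorm_le_norm _) _; rewrite mulrC.
Qed.

Let K_tb := seq_clustering_tot_bounded p_sn limsup_clustering.

Let p_recurrent := isometry_recurrent p_sn limsup_seminorm_iso limsup_clustering limsup_attracted.

Let p_ball := ball_tot_bounded_setT p_sn limsup_seminorm_iso K_tb limsup_clustering limsup_attracted.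

Lemma limsup_seminorm_iter n x : p (iter n T x) = p x.
Proof. exact: (seminorm_iter limsup_seminorm_iso). Qed.

(** Pigeonhole on pairs from a finite net of a [p]-ball: at two of the times, the iterates of [x]
    and [y] are near the same pair, and the isometry cancels the earlier time. *)
Lemma joint_recurrence x y e : 0 < e -> forall N, exists m,
  [/\ (N <= m)%N, p (iter m T x - x) < e & p (iter m T y - y) < e].
Proof.
move=> e0 N; have e2 : 0 < e / 2 by rewrite divr_gt0.
have [s sP] := p_ball (Num.max (p x) (p y)) e2.
(* Multiples of [N.+1] make differences of distinct times exceed [N]. *)
pose time k := (k * N.+1)%N.
have /choice[g gP] : forall k, exists z : X * X, [/\ z \in [seq (u, v) | u <- s, v <- s],
    p (iter (time k) T x - z.1) < e / 2 & p (iter (time k) T y - z.2) < e / 2].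
  move=> k; have [|u us lu] := sP (iter (time k) T x).
    by split => //; rewrite limsup_seminorm_iter le_max lexx.
  have [|v vs lv] := sP (iter (time k) T y).
    by split => //; rewrite limsup_seminorm_iter le_max lexx orbT.
  by exists (u, v); split => //; apply/allpairsP; exists (u, v).
pose t := [seq (u, v) | u <- s, v <- s].
have /(uniqPn (0, 0))[i [j [ij]]] : ~~ uniq [seq g k | k <- iota 0 (size t).+1].
  apply/negP => /(@uniq_leq_size _ _ t).
  rewrite size_map size_iota ltnn => h; suff : false by [].
  by apply: h => _ /mapP[k _ ->]; case: (gP k).
rewrite size_map size_iota => jt.
rewrite !(nth_map 0%N) ?size_iota ?(ltn_trans ij jt) // !nth_iota ?(ltn_trans ij jt) //.
rewrite !add0n => gij; have le_ij : (time i <= time j)%N by rewrite leq_mul2r ltnW ?orbT.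
exists (time j - time i)%N; split.
- rewrite -mulnBl; apply: leq_trans (leqnSn N) _.
  by rewrite leq_pmull // subn_gt0.
- rewrite -(limsup_seminorm_iter (time i)) iter_linB -iterD subnKC //.
  have [_ l1 _] := gP i; have [_ l2 _] := gP j; rewrite gij in l1.
  have := seminorm_triangle p_sn (g j).1 (iter (time j) T x) (iter (time i) T x).
  by rewrite (seminorm_distC p_sn (g j).1); lra.
rewrite -(limsup_seminorm_iter (time i)) iter_linB -iterD subnKC //.
have [_ _ l1] := gP i; have [_ _ l2] := gP j; rewrite gij in l1.
have := seminorm_triangle p_sn (g j).2 (iter (time j) T y) (iter (time i) T y).
by rewrite (seminorm_distC p_sn (g j).2); lra.
Qed.

Lemma returning_subspace : is_subspace (returning T).
Proof.
split=> [|c u v ru rv]; apply/returningP => e e0 N.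
  exists N => //; have := iter_linB T N 0 0; rewrite !subrr => ->.
  by rewrite subrr (seminorm0 n_sn).
have e2 : 0 < e / 2 by rewrite divr_gt0.
have c1 : 0 < babs c + 1 by have := babs_ge0 c; lra.
have [m [Nm]] := joint_recurrence u v (divr_gt0 e2 c1) N.
rewrite !ltr_pdivlMr // => lu lv; exists m => //.
have -> : iter m T (c *: u + v) - (c *: u + v) = c *: (iter m T u - u) + (iter m T v - v).
  by rewrite iter_linD iter_linZ scalerBr opprD addrACA.
have := seminormD n_sn (c *: (iter m T u - u)) (iter m T v - v); rewrite (seminormZ n_sn).
(* [T^m u - u] and [T^m v - v] are returning, which turns joint recurrence in [p] into recurrence in
   norm. *)
have := returning_le (returning_iterB m 0 ru); have := returning_le (returning_iterB m 0 rv).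
rewrite /= => hv hu; have := babs_ge0 c; have := seminorm_ge0 p_sn (iter m T u - u).
have := seminorm_ge0 p_sn (iter m T v - v); nra.
Qed.

Lemma orbit_cluster x : exists a, clusters_at nrm (fun n => iter n T x) a.
Proof.
have c1 : 0 < rnorm x + 1 by have := seminorm_ge0 n_sn x; lra.
apply: (attracted_cluster n_sn (K := [set of_base b (rnorm x + 1) *: k | k in K])).
  exact/(seq_clusteringZ n_sn)/compact_seq_clustering.
apply: (attractedZ n_sn c1).
have := @norm_attracted (of_base b (rnorm x + 1)^-1 *: x).
rewrite (seminorm_normalize n_sn) ?invr_ge0 ?(ltW c1) // mulrC ler_pdivrMr // mul1r.
have -> : (fun n => iter n T (of_base b (rnorm x + 1)^-1 *: x)) =
          (fun n => of_base b (rnorm x + 1)^-1 *: iter n T x).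
  by apply/funext => n; rewrite iter_linZ.
by apply; rewrite lerDl.
Qed.

(** If [T^n x] and a later [T^m x] are near [a], then [T^(m - n) a] is near [T^m x] by power
    boundedness, hence near [a]. *)
Lemma orbit_cluster_returning x a :
  clusters_at nrm (fun n => iter n T x) a -> returning T a.
Proof.
move=> xa; apply/returningP => e e0 N.
have d0 : 0 < e / (M + 1) by rewrite divr_gt0 // addr_gt0.
have dE : M * (e / (M + 1)) + e / (M + 1) = e by field; rewrite gt_eqF // addr_gt0.
have [n _ ln] := xa _ d0 0%N; have [m nm lm] := xa _ d0 (n + N)%N.
have le_nm : (n <= m)%N := leq_trans (leq_addr _ _) nm.
exists (m - n)%N; first by rewrite leq_subRL.
move: (e / (M + 1)) d0 dE ln lm => d d0 dE ln lm.
have kE : iter (m - n) T a - iter m T x = iter (m - n) T (a - iter n T x).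
  by rewrite iter_linB -iterD subnK.
have := seminorm_triangle n_sn (iter m T x) (iter (m - n) T a) a; rewrite kE.
have := TM (m - n) (a - iter n T x); rewrite (seminorm_distC n_sn a).
by have := ler_wpM2l (ltW M0) (ltW ln); lra.
Qed.

(* Shifting a returning cluster point [a] of the orbit of [x] along return times
   gives a sequence converging to the returning part of [x]. *)
Lemma returning_part x : exists2 l, returning T l & p (x - l) = 0.
Proof.
have [a xa] := orbit_cluster x; have ra := orbit_cluster_returning xa.
(* [T^n x] is near [a] and [T^k x] returns near [x], so [T^(k - n) a] is near [x] in the
   seminorm. *)
have /choice[m mP] : forall j : nat, exists m, p (x - iter m T a) < j.+1%:R^-1.
  move=> j; have : 0 < j.+1%:R^-1 :> R by rewrite invr_gt0.
  move: (j.+1%:R^-1 : R) => i i0.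
  have d0 : 0 < i / (M + 1) by rewrite divr_gt0 // addr_gt0.
  have dE : M * (i / (M + 1)) + i / (M + 1) = i by field; rewrite gt_eqF // addr_gt0.
  have [n _ ln] := xa _ d0 0%N; have [k nk lk] := p_recurrent x n d0.
  exists (k - n)%N.
  move: (i / (M + 1)) d0 dE ln lk => d d0 dE ln lk.
  have := seminorm_triangle p_sn (iter k T x) x (iter (k - n) T a).
  have -> : iter k T x - iter (k - n) T a = iter (k - n) T (iter n T x - a).
    by rewrite iter_linB -iterD subnK.
  rewrite limsup_seminorm_iter.
  have := limsup_seminorm_le_norm (iter n T x - a).
  by rewrite (seminorm_distC p_sn x (iter k T x)); have := ler_wpM2l (ltW M0) (ltW ln); lra.
have small e : 0 < e -> exists N, forall n, (N <= n)%N -> p (x - iter (m n) T a) < e.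
  move=> /invS_lt[N NP]; exists N => n Nn; exact: lt_trans (mP n) (NP n Nn).
(* Differences of iterates of [a] are returning, so Cauchy in [p] implies Cauchy in norm. *)
have [|l lP] := @rnorm_complete R b X (fun n => iter (m n) T a).
  move=> e e0; have e2 : 0 < e / 2 by rewrite divr_gt0.
  have [N NP] := small _ e2; exists N => i j /NP hi /NP hj.
  apply: le_lt_trans (returning_le (returning_iterB _ _ ra)) _.
  apply: le_lt_trans (seminorm_triangle p_sn x _ _) _.
  by rewrite [e]splitr ltrD // (seminorm_distC p_sn).
exists l.
  apply: returning_closed => e /lP[N /(_ _ (leqnn N))]; rewrite (seminorm_distC n_sn).
  by exists (iter (m N) T a) => //; exact: returning_iter.
apply/le_anti; rewrite (seminorm_ge0 p_sn) andbT; apply/ler_addgt0Pr => e e0.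
have e2 : 0 < e / 2 by rewrite divr_gt0.
have [N NP] := small _ e2; have [N' NP'] := lP _ (divr_gt0 e2 M0).
pose n := maxn N N'; have h := NP n (leq_maxl _ _).
have := NP' n (leq_maxr _ _); rewrite ltr_pdivlMr // => h'.
have := seminorm_triangle p_sn (iter (m n) T a) x l.
by have := limsup_seminorm_le_norm (iter (m n) T a - l); lra.
Qed.

(** Generators of [X] modulo the kernel of [p] are replaced by their returning parts. A returning
    vector differs from some element of their span by a returning vector in that kernel, which is
    zero. *)
Lemma returning_finite_dim : finite_dim (returning T).
Proof.
have [s sP] := ball_tot_bounded_finite_dim p_sn p_ball.
have /choice[f fP] : forall x, exists l, returning T l /\ p (x - l) = 0.
  by move=> x; have [l rl xl] := returning_part x; exists l.
have Ls := returning_subspace.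
have lift_span y : forall t, seq_span t y -> exists2 z, seq_span (map f t) z & p (y - z) = 0.
  move=> t; elim: t y => [y ->|a t IH y [c /IH[z tz yz]]] /=.
    by exists 0 => //; rewrite subrr (seminorm0 p_sn).
  exists (z + c *: f a); first by exists c; rewrite addrK.
  apply/le_anti; rewrite (seminorm_ge0 p_sn) andbT.
  have -> : y - (z + c *: f a) = (y - c *: a - z) + c *: (a - f a).
    by rewrite scalerBr addrA [y - _ - z]addrAC subrK opprD addrA.
  apply: le_trans (seminormD p_sn _ _) _.
  by rewrite yz (seminormZ p_sn) (fP a).2 mulr0 addr0.
exists [set` map f s]; first exact: finite_seq.
apply/seteqP; split => [l rl|]; last first.
  by apply: linspan_subset => // _ /mapP[x _ ->]; case: (fP x).
have [y sy ly] := sP l; have [z tz yz] := lift_span _ _ sy.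
have zL := seq_span_linspan tz.
suff -> : l = z by [].
have rz : returning T z.
  by apply: linspan_subset zL => // _ /mapP[x _ ->]; case: (fP x).
apply/subr0_eq/rnorm_eq0/le_anti; rewrite (seminorm_ge0 n_sn) andbT.
apply: le_trans (returning_le (subspaceB Ls rl rz)) _.
by have := seminorm_triangle p_sn y l z; lra.
Qed.

End PowerBounded.

(** * The decomposition *)

Theorem theorem2 (R : realType) (b : base_field)
  (X : completeNormedModType (base_fieldType R b)) (T : {linear X -> X})
  (T_pb : power_bounded T)
  (K : set X) (K_compact : compact K)
  (K_attr : forall x : X, rnorm x <= 1 ->
     limn_einf (fun n => rdist (iter n T x) K) = 0%E) :
  exists L : set X,
    [/\ [/\ is_subspace L, stable_under T L & finite_dim L],
        (forall x : X, rdist (iter n T x) L @[n --> \oo] --> 0%E),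
        (exists X0 : set X,
           [/\ [/\ is_subspace X0, closed X0 & stable_under T X0],
               direct_sum X0 L,
               (forall (n : nat) (x0 l : X), X0 x0 -> L l ->
                  [/\ X0 (iter n T x0), L (iter n T l) &
                      iter n T (x0 + l) = iter n T x0 + iter n T l]) &
               (forall x0 : X, X0 x0 ->
                  iter n T x0 @[n --> \oo] --> (0 : X))]) &
        L = linspan (returning T)].
Proof.
have [M M0 TM] := power_bounded_bound T_pb.
pose p := limsup_seminorm T.
have p_sn : seminorm p := limsup_seminormP TM.
have n_sn := rnorm_seminorm X.
have Ls := returning_subspace M0 TM K_compact K_attr.
have p_iter n x : p (iter n T x) = p x := limsup_seminorm_iter TM n x.
have L_iter n l : returning T l -> returning T (iter n T l) := fun rl => returning_iter M0 TM n rl.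
have decomp x : exists x0 l, [/\ p x0 = 0, returning T l & x = x0 + l].
  have [l rl xl] := returning_part M0 TM K_compact K_attr x.
  by exists (x - l), l; rewrite subrK.
have cvg0 x : p x = 0 <-> iter n T x @[n --> \oo] --> (0 : X).
  exact: limsup_seminorm_eq0 TM x.
exists (returning T); split.
- split=> //; first by move=> _ [l rl <-]; exact: (L_iter 1%N).
  exact (returning_finite_dim M0 TM K_compact K_attr).
(* [T^n l] lies in [L], so the distance is at most the norm of [T^n x0]. *)
- move=> x; have [x0 [l [/cvg0/cvg_rnorm x00 rl ->]]] := decomp x.
  apply: (@squeeze_cvge _ _ _ _ (cst 0%E) _ (fun n => (rnorm (iter n T x0))%:E)).
  + apply: nearW => n; rewrite rdist_ge0 /=; apply: ereal_inf_lbound.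
    exists (iter n T l); first exact: L_iter.
    by rewrite iter_linD addrK.
  + exact: cvg_cst.
  + apply/cvg_EFin; first exact: nearW.
    apply/cvgrPdist_lt => e e0; have [N NP] := x00 e e0.
    exists N => // n /= Nn; have := NP n Nn; rewrite subr0 sub0r normrN.
    by rewrite ger0_norm // (seminorm_ge0 n_sn).
- exists [set x | p x = 0]; split.
  + split.
    * split=> [|c u v /= u0 v0]; first exact: seminorm0.
      apply/le_anti; rewrite (seminorm_ge0 p_sn) andbT.
      apply: le_trans (seminormD p_sn _ _) _.
      by rewrite (seminormZ p_sn) u0 v0 mulr0 addr0.
    (* The kernel of [p] is closed because [p] is bounded by [M] times the norm. *)
    * move=> x cx /=; apply/le_anti; rewrite (seminorm_ge0 p_sn) andbT.
      apply/ler_addgt0Pr => e e0; rewrite add0r.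
      have d0 : 0 < e / M by rewrite divr_gt0.
      have [y [/= y0]] := cx _ (nbhsx_ballx x _ (of_base_gt0 b d0)).
      rewrite -ball_normE /= -rnorm_lt ?of_base_gt0 // of_baseK ltr_pdivlMr // => lt.
      have := seminorm_le_dist p_sn x y.
      by have := limsup_seminorm_le_norm TM (x - y); rewrite -/p y0; lra.
    * by move=> _ [x /= x0 <-]; rewrite -[T x]/(iter 1 T x) p_iter.
  + split=> [x|]; first by have [x0 [l [x00 rl ->]]] := decomp x; exists x0, l.
    apply/seteqP; split=> [x [/= x0 rx]|_ ->].
      (* A returning vector has norm at most [p x], which is zero here. *)
      apply: rnorm_eq0; apply/le_anti; rewrite (seminorm_ge0 n_sn) andbT -x0.
      exact (returning_le TM rx).
    by split; [exact: (seminorm0 p_sn)|exact: subspace0].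
  + by move=> n x0 l x00 rl; split; rewrite /= ?p_iter ?iter_linD //; exact: L_iter.
  + by move=> x0 /= /cvg0.
apply/seteqP; split; first exact: sub_linspan.
exact: linspan_subset.
Qed.
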